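(* Let $x^*=(u^*,q^*,\alpha^*,r^*,\delta^*,\theta^* )$ be feasible for $(\mathrm{P}_{TV})$, assume that $\nabla_\alpha Q(\alpha^* )^\top$ has full rank, that $\mathcal B(x^* )\cap\{i:Q(\alpha^* )_i=0\}=\emptyset$, and that $x^*$ is strongly stationary (there exist multipliers satisfying the stationarity system below together with $\gamma_i\ge0,\nu_i\ge0$ on $\mathcal B(x^* )$). Suppose that for every multiplier vector $(p,\lambda^x,\lambda^y,\varphi^x,\varphi^y,\rho,\sigma,\gamma,\nu)$ satisfying the M-stationarity system below, and every nonzero critical direction $d=(d_u,d_q,d_\alpha,d_r,d_\delta,d_\theta)\in\mathcal C(x^* )$, \begin{multline*} \langle\nabla^2\mathcal J(u^* )d_u,d_u\rangle-D^3\mathcal D(u^* )[p,d_u,d_u]-\Big(\sum_{i\in\mathcal I\cup\mathcal B}\|\varphi_i\|^2\Big)\|\mathbb K\|^2\|d_u\|^2-\sum_{i=1}^m(\rho_i+\nu_i)\,d_\alpha^\top\nabla^2Q_i(\alpha^* )d_\alpha\\ -\Big(\sum_{i\in\mathcal I}\|(\mathbb Kp)_i\|^2\Big)\Big(\sum_{i\in\mathcal I}(\nabla Q_i(\alpha^* )^\top d_\alpha)^2\Big)+\sum_{i\in\mathcal I}(\delta^*_i\nu_i-2)d_{\theta,i}^2+\sum_{i\in\mathcal B}(\delta^*_i\nu_i-1)d_{\theta,i}^2>0, \end{multline*} where $\mathcal I=\mathcal I(x^* )$, $\mathcal B=\mathcal B(x^* )$, $\varphi_i=(\varphi^x_i,\varphi^y_i)^\top$.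 Then $x^*$ is a strict local minimizer of $(\mathrm{P}_{TV})$.
   Context: Let $d,m,k\ge1$. Let $K_x,K_y\in\mathbb R^{m\times d}$ and define the linear map $\mathbb K:\mathbb R^d\to(\mathbb R^2)^m$ by $(\mathbb Ku)_i=((K_xu)_i,(K_yu)_i)^\top$, with operator norm $\|\mathbb K\|$. For $q=(q_1,\dots,q_m)\in(\mathbb R^2)^m$ with $q_i=(q_i^x,q_i^y)^\top$ write $q^x=(q^x_i)_i,\ q^y=(q^y_i)_i\in\mathbb R^m$ and $\mathbb K^\top q:=K_x^\top q^x+K_y^\top q^y$. Let $\mathcal D:\mathbb R^d\to\mathbb R$ be convex and three times continuously differentiable (gradient $\nabla\mathcal D$, Hessian $\nabla^2\mathcal D$, third derivative $D^3\mathcal D$ as a trilinear form), $\mathcal J:\mathbb R^d\to\mathbb R$ twice continuously differentiable, and $Q:\mathbb R^k\to\mathbb R^m$ twice continuously differentiable with components $Q_i=Q(\cdot)_i$; $\nabla_\alpha Q(\alpha)^\top\in\mathbb R^{k\times m}$ denotes the transpose of the Jacobian, ''full rank'' means rank $\min(k,m)$. $\circ$ is the componentwise product; $\cos,\sin$ act componentwise. Problem $(\mathrm{P}_{TV})$: minimize $\mathcal J(u)$ over $x=(u,q,\alpha,r,\delta,\theta)\in\mathbb R^d\times(\mathbb R^2)^m\times\mathbb R^k\times\mathbb R^m\times\mathbb R^m\times\mathbb R^m$ subject to $\nabla\mathcal D(u)+\mathbb K^\top q=0$; $(\mathbb Ku)_i=r_i(\cos\theta_i,\sin\theta_i)^\top$,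 $q_i=\delta_i(\cos\theta_i,\sin\theta_i)^\top$ ($i=1,\dots,m$); $Q(\alpha)\ge0$; $\delta\ge0$; $0\le r_i\perp(Q(\alpha)_i-\delta_i)\ge0$ ($i=1,\dots,m$). Index sets: $\mathcal A(x)=\{i:r_i=0,Q(\alpha)_i>\delta_i\}$, $\mathcal I(x)=\{i:r_i>0,Q(\alpha)_i=\delta_i\}$, $\mathcal B(x)=\{i:r_i=0,Q(\alpha)_i=\delta_i\}$. M-stationarity system (multipliers $p\in\mathbb R^d$, $\lambda^x,\lambda^y,\varphi^x,\varphi^y,\rho,\sigma,\gamma,\nu\in\mathbb R^m$): $\nabla\mathcal J(u^* )-\nabla^2\mathcal D(u^* )p-K_x^\top\varphi^x-K_y^\top\varphi^y=0$; $\nabla_\alpha Q(\alpha^* )^\top(\rho+\nu)=0$; $\lambda^x=K_xp$, $\lambda^y=K_yp$; $\cos\theta^*\circ\varphi^x+\sin\theta^*\circ\varphi^y-\gamma=0$; $-\cos\theta^*\circ\lambda^x-\sin\theta^*\circ\lambda^y-\sigma+\nu=0$; $\sin\theta^*\circ(-r^*\circ\varphi^x+\delta^*\circ\lambda^x)-\cos\theta^*\circ(-r^*\circ\varphi^y+\delta^*\circ\lambda^y)=0$; $0\le Q(\alpha^* )\perp\rho\ge0$; $0\le\delta^*\perp\sigma\ge0$; $\nu_i=0$ on $\mathcal A(x^* )$; $\gamma_i=0$ on $\mathcal I(x^* )$; and on $\mathcal B(x^* )$ either $\gamma_i\nu_i=0$ or $\gamma_i,\nu_i\ge0$. Critical cone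 $\mathcal C(x^* )$: directions $d=(d_u,d_q,d_\alpha,d_r,d_\delta,d_\theta)$ with $\nabla\mathcal J(u^* )^\top d_u\le0$ and $-\nabla^2\mathcal D(u^* )d_u-K_x^\top d_q^x-K_y^\top d_q^y=0$; $-K_xd_u+\cos\theta^*\circ d_r-r^*\circ\sin\theta^*\circ d_\theta=0$; $-K_yd_u+\sin\theta^*\circ d_r+r^*\circ\cos\theta^*\circ d_\theta=0$; $d_q^x-\cos\theta^*\circ d_\delta+\delta^*\circ\sin\theta^*\circ d_\theta=0$; $d_q^y-\sin\theta^*\circ d_\delta-\delta^*\circ\cos\theta^*\circ d_\theta=0$; $\nabla Q_i(\alpha^* )^\top d_\alpha\ge0$ if $Q(\alpha^* )_i=0$; $d_{\delta,i}\ge0$ if $\delta^*_i=0$; $\nabla Q_i(\alpha^* )^\top d_\alpha=d_{\delta,i}$ for $i\in\mathcal I(x^* )$; $d_{r,i}=0$ for $i\in\mathcal A(x^* )$; and $0\le(\nabla Q_i(\alpha^* )^\top d_\alpha-d_{\delta,i})\perp d_{r,i}\ge0$ for $i\in\mathcal B(x^* )$. *)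

(* Defs.v *)
From HB Require Import structures.
From mathcomp Require Import all_boot all_order all_algebra.
From mathcomp Require Import all_classical all_reals.
From mathcomp Require Import topology normedtype derive trigo.
Set Implicit Arguments.
Unset Strict Implicit.
Unset Printing Implicit Defensive.
Import Order.TTheory GRing.Theory Num.Theory.
Import numFieldNormedType.Exports.
Local Open Scope ring_scope.
Local Open Scope classical_set_scope.

Section Defs.
Variable R : realType.
Notation V n := 'cV[R]_n.

Definition evec n (i : 'I_n) : V n := delta_mx i 0.

Definition d1 n (f : V n -> R) (u h : V n) : R := 'd f u h.
Definition d2 n (f : V n -> R) (u h k : V n) : R := 'd (fun v => d1 f v h) u k.
Definition d3 n (f : V n -> R) (u h k l : V n) : R :=
  'd (fun v => d2 f v h k) u l.

Definition grad n (f : V n -> R) (u : V n) : V n := \col_i d1 f u (evec i).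
Definition hessmul n (f : V n -> R) (u p : V n) : V n := \col_i d2 f u (evec i) p.

Definition C2 n (f : V n -> R) : Prop :=
  (forall u, differentiable f u) /\
  (forall h u, differentiable (fun v => d1 f v h) u) /\
  (forall h k, continuous (fun v => d2 f v h k)).
Definition C3 n (f : V n -> R) : Prop :=
  (forall u, differentiable f u) /\
  (forall h u, differentiable (fun v => d1 f v h) u) /\
  (forall h k u, differentiable (fun v => d2 f v h k) u) /\
  (forall h k l, continuous (fun v => d3 f v h k l)).

Definition convex_fun n (f : V n -> R) : Prop :=
  forall u v (t : R), 0 <= t <= 1 ->
    f (t *: u + (1 - t) *: v) <= t * f u + (1 - t) * f v.

Definition sqn n (v : V n) : R := \sum_i v i 0 ^+ 2.
Definition dotv n (v w : V n) : R := \sum_i v i 0 * w i 0.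

Variables (d m k : nat).

(* operator norm of K : R^d -> (R^2)^m, Euclidean norms *)
Definition opnormK (Kx Ky : 'M[R]_(m, d)) : R :=
  sup [set Num.sqrt (sqn (Kx *m u) + sqn (Ky *m u)) | u in [set u : V d | sqn u = 1]].

Definition Qc (Q : V k -> V m) (i : 'I_m) : V k -> R := fun a => Q a i 0.
Definition JQt (Q : V k -> V m) (a : V k) : 'M[R]_(k, m) :=
  \matrix_(j, i) d1 (Qc Q i) a (evec j).
Definition gQ (Q : V k -> V m) (a : V k) (i : 'I_m) (da : V k) : R :=
  dotv (grad (Qc Q i) a) da.

Record tvpoint := TVPoint {
  xu : V d; xqx : V m; xqy : V m; xal : V k; xr : V m; xdel : V m; xth : V m }.

Record tvmult := TVMult {
  mp : V d; mlx : V m; mly : V m; mphx : V m; mphy : V m;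
  mrho : V m; msig : V m; mgam : V m; mnu : V m }.

Variables (Kx Ky : 'M[R]_(m, d)) (Df J : V d -> R) (Q : V k -> V m).

Definition feasible (x : tvpoint) : Prop :=
  grad Df (xu x) + Kx^T *m xqx x + Ky^T *m xqy x = 0 /\
  (forall i, (Kx *m xu x) i 0 = xr x i 0 * cos (xth x i 0) /\
             (Ky *m xu x) i 0 = xr x i 0 * sin (xth x i 0)) /\
  (forall i, xqx x i 0 = xdel x i 0 * cos (xth x i 0) /\
             xqy x i 0 = xdel x i 0 * sin (xth x i 0)) /\
  (forall i, 0 <= Q (xal x) i 0) /\
  (forall i, 0 <= xdel x i 0) /\
  (forall i, 0 <= xr x i 0 /\ 0 <= Q (xal x) i 0 - xdel x i 0 /\
             xr x i 0 * (Q (xal x) i 0 - xdel x i 0) = 0).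

Definition inA (x : tvpoint) (i : 'I_m) : bool :=
  (xr x i 0 == 0) && (Q (xal x) i 0 > xdel x i 0).
Definition inI (x : tvpoint) (i : 'I_m) : bool :=
  (xr x i 0 > 0) && (Q (xal x) i 0 == xdel x i 0).
Definition inB (x : tvpoint) (i : 'I_m) : bool :=
  (xr x i 0 == 0) && (Q (xal x) i 0 == xdel x i 0).

Definition Mstat (x : tvpoint) (y : tvmult) : Prop :=
  let u := xu x in let a := xal x in let r := xr x in
  let dl := xdel x in let th := xth x in
  grad J u - hessmul Df u (mp y) - Kx^T *m mphx y - Ky^T *m mphy y = 0 /\
  JQt Q a *m (mrho y + mnu y) = 0 /\
  mlx y = Kx *m mp y /\ mly y = Ky *m mp y /\
  (forall i, cos (th i 0) * mphx y i 0 + sin (th i 0) * mphy y i 0 - mgam y i 0 = 0) /\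
  (forall i, - cos (th i 0) * mlx y i 0 - sin (th i 0) * mly y i 0
             - msig y i 0 + mnu y i 0 = 0) /\
  (forall i, sin (th i 0) * (- r i 0 * mphx y i 0 + dl i 0 * mlx y i 0)
           - cos (th i 0) * (- r i 0 * mphy y i 0 + dl i 0 * mly y i 0) = 0) /\
  (forall i, 0 <= Q a i 0 /\ 0 <= mrho y i 0 /\ Q a i 0 * mrho y i 0 = 0) /\
  (forall i, 0 <= dl i 0 /\ 0 <= msig y i 0 /\ dl i 0 * msig y i 0 = 0) /\
  (forall i, inA x i -> mnu y i 0 = 0) /\
  (forall i, inI x i -> mgam y i 0 = 0) /\
  (forall i, inB x i ->
     mgam y i 0 * mnu y i 0 = 0 \/ (0 <= mgam y i 0 /\ 0 <= mnu y i 0)).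

Definition Sstat (x : tvpoint) : Prop :=
  exists y, Mstat x y /\
    (forall i, inB x i -> 0 <= mgam y i 0 /\ 0 <= mnu y i 0).

Definition critical (x : tvpoint) (dd : tvpoint) : Prop :=
  let u := xu x in let a := xal x in let r := xr x in
  let dl := xdel x in let th := xth x in
  let du := xu dd in let dqx := xqx dd in let dqy := xqy dd in
  let da := xal dd in let dr := xr dd in let ddl := xdel dd in
  let dth := xth dd in
  d1 J u du <= 0 /\
  - hessmul Df u du - Kx^T *m dqx - Ky^T *m dqy = 0 /\
  (forall i, - (Kx *m du) i 0 + cos (th i 0) * dr i 0
             - r i 0 * sin (th i 0) * dth i 0 = 0) /\
  (forall i, - (Ky *m du) i 0 + sin (th i 0) * dr i 0
             + r i 0 * cos (th i 0) * dth i 0 = 0) /\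
  (forall i, dqx i 0 - cos (th i 0) * ddl i 0 + dl i 0 * sin (th i 0) * dth i 0 = 0) /\
  (forall i, dqy i 0 - sin (th i 0) * ddl i 0 - dl i 0 * cos (th i 0) * dth i 0 = 0) /\
  (forall i, Q a i 0 = 0 -> 0 <= gQ Q a i da) /\
  (forall i, dl i 0 = 0 -> 0 <= ddl i 0) /\
  (forall i, inI x i -> gQ Q a i da = ddl i 0) /\
  (forall i, inA x i -> dr i 0 = 0) /\
  (forall i, inB x i -> 0 <= gQ Q a i da - ddl i 0 /\ 0 <= dr i 0 /\
                        (gQ Q a i da - ddl i 0) * dr i 0 = 0).

Definition zero_point : tvpoint := TVPoint 0 0 0 0 0 0 0.

Definition soc_expr (x : tvpoint) (y : tvmult) (dd : tvpoint) : R :=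
  let u := xu x in let a := xal x in
  let du := xu dd in let da := xal dd in let dth := xth dd in
  d2 J u du du - d3 Df u (mp y) du du
  - (\sum_(i | inI x i || inB x i) (mphx y i 0 ^+ 2 + mphy y i 0 ^+ 2))
      * opnormK Kx Ky ^+ 2 * sqn du
  - \sum_i (mrho y i 0 + mnu y i 0) * d2 (Qc Q i) a da da
  - (\sum_(i | inI x i) ((Kx *m mp y) i 0 ^+ 2 + (Ky *m mp y) i 0 ^+ 2))
      * (\sum_(i | inI x i) gQ Q a i da ^+ 2)
  + \sum_(i | inI x i) (xdel x i 0 * mnu y i 0 - 2) * dth i 0 ^+ 2
  + \sum_(i | inB x i) (xdel x i 0 * mnu y i 0 - 1) * dth i 0 ^+ 2.

Definition pdist2 (x z : tvpoint) : R :=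
  sqn (xu x - xu z) + sqn (xqx x - xqx z) + sqn (xqy x - xqy z)
  + sqn (xal x - xal z) + sqn (xr x - xr z) + sqn (xdel x - xdel z)
  + sqn (xth x - xth z).

Definition strict_local_min (xs : tvpoint) : Prop :=
  feasible xs /\
  exists eps : R, 0 < eps /\
    forall x, feasible x -> x <> xs -> pdist2 x xs < eps -> J (xu xs) < J (xu x).

End Defs.

(* Main.v *)
Require Import Defs.
From HB Require Import structures.
From mathcomp Require Import all_boot all_order all_algebra.
From mathcomp Require Import all_classical all_reals.
From mathcomp Require Import topology normedtype sequences realfun derive trigo.
From mathcomp Require Import ring lra.
Set Implicit Arguments.
Unset Strict Implicit.
Unset Printing Implicit Defensive.
Import Order.TTheory GRing.Theory Num.Theory.
Import numFieldNormedType.Exports.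
Local Open Scope ring_scope.
Local Open Scope classical_set_scope.

(* If xs were not a strict local minimizer, there would be feasible points
   xs + t_n D_n with t_n -> 0+, |D_n| = 1 and J no larger than at xs.  Along an
   ultrafilter D_n converges to a unit vector dd, which is critical.  The
   Lagrangian L at a strongly stationary multiplier satisfies L <= J at nearby
   feasible points, L = J at xs, and its first derivative at xs vanishes, so a
   second-order expansion forces L''(xs)[dd, dd] <= 0.  But Young's inequality on
   the polar cross terms gives soc_expr <= L''(xs)[dd, dd], contradicting the
   hypothesis.  Young applies since r_i and delta_i never vanish together: a
   pure rotation of theta_i would otherwise be a nonzero critical direction with
   soc_expr = 0. *)

(** The feasible points approach [xs] along chords, with no feasible curve through them and no rate
    for the convergence of the directions. Replacing D_n by its limit in a linear term would leave
    an error o(1) / t_n, which need not be bounded. All expansions therefore keep the actual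
    direction in the linear term and pass to the limit only in the quadratic one. This suffices
    because stationarity annihilates the derivative of the Lagrangian in every direction, hence
    along each D_n exactly. The estimate L <= J is a matter of signs. Close to [xs] the equations
    r_i = 0 on A and Q_i = delta_i on I persist, while nu_i = 0 on A and gamma_i = 0 on I, so gamma
    and nu need a sign only on B; strong stationarity supplies it. The ultrafilter makes all bounded
    coordinates converge at once, which replaces successive extraction of subsequences. *)

Lemma cvg_mx_coord (R : realType) (T : Type) (F : set_system T) (m n : nat)
    (h : T -> 'M[R]_(m, n)) (M : 'M[R]_(m, n)) :
  Filter F -> (forall i j, h x i j @[x --> F] --> M i j) -> h @ F --> M.
Proof.
move=> FF hM A [P MP PA]; apply: (@filterS _ F) (_ : F [set x | forall i j, P i j (h x i j)]).
  by move=> x Px; apply: PA.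
apply: filter_forall => i; apply: filter_forall => j.
exact: hM (MP i j).
Qed.

(** * Second-order Taylor expansion and symmetry of second derivatives *)

Lemma is_derive_line (R : realType) (n : nat) (f : 'cV[R]_n -> R)
    (u h : 'cV[R]_n) (s : R) :
  differentiable f (u + s *: h) ->
  is_derive s 1 (fun t : R => f (u + t *: h)) (d1 f (u + s *: h) h).
Proof.
move=> df; have hE : (fun t : R => t^-1 *: (((fun t : R => f (u + t *: h)) \o shift s) (t *: 1) - f (u + s *: h)))
  = (fun t : R => t^-1 *: ((f \o shift (u + s *: h)) (t *: h) - f (u + s *: h))).
  apply/funext => t /=; congr (_ *: (f _ - _)).
  by rewrite [t%:A]mulr1 scalerDl addrCA.
split.
- rewrite /derivable hE; exact: diff_derivable.
- rewrite /derive hE /d1 -deriveE //.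
Qed.

Lemma is_derive_within_continuous (R : realType) (f f1 : R -> R) (a b : R) :
  (forall s : R, is_derive s 1 f (f1 s)) -> {within `[a, b], continuous f}.
Proof.
move=> df; apply: continuous_subspaceT => x.
exact/differentiable_continuous/derivable1_diffP.
Qed.

(** Subtracting from [f] its linear part and [M * s ^+ 2], with [M] chosen so that [g t = g 0],
    allows Rolle's argument twice: [g1] vanishes at some [c] and at 0, so its derivative
    [f2 s - M * 2] vanishes in between. *)
Lemma taylor2_lagrange (R : realType) (f f1 f2 : R -> R) (t : R) :
  (forall s : R, is_derive s 1 f (f1 s)) -> (forall s : R, is_derive s 1 f1 (f2 s)) ->
  0 < t ->
  exists2 s, 0 < s < t & f t = f 0 + t * f1 0 + t ^+ 2 * (f2 s / 2).
Proof.
move=> df df1 t0.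
pose M := (f t - f 0 - t * f1 0) / t ^+ 2.
pose g (s : R) := f s - s * f1 0 - M * s ^+ 2.
pose g1 (s : R) := f1 s - f1 0 - M * 2 * s.
have dg (s : R) : is_derive s 1 g (g1 s).
  by apply: is_derive_eq; rewrite /GRing.scale /= /g1; ring.
have dg1 (s : R) : is_derive s 1 g1 (f2 s - M * 2).
  by apply: is_derive_eq; rewrite /GRing.scale /=; ring.
have [c] := @MVT R g g1 0 t t0 (fun x _ => dg x) (is_derive_within_continuous dg).
rewrite in_itv /= => /andP[c0 ct] gc.
have g1c : g1 c = 0.
  apply: (mulIf (lt0r_neq0 t0)); rewrite mul0r -{1}[t]subr0 -gc /g /M.
  by field; exact: lt0r_neq0.
have [s] := @MVT R g1 _ 0 c c0 (fun x _ => dg1 x) (is_derive_within_continuous dg1).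
rewrite in_itv /= => /andP[s0 sc] g1s.
have Ms : M = f2 s / 2.
  have : (f2 s - M * 2) * c = 0 by rewrite -[c]subr0 -g1s g1c /g1; ring.
  by move/eqP; rewrite mulf_eq0 (gt_eqF c0) orbF subr_eq0 => /eqP ->; field.
exists s; first by rewrite s0 (lt_trans sc).
by rewrite -Ms /M; field; exact: lt0r_neq0.
Qed.

Lemma sum_evec (R : realType) (n : nat) (h : 'cV[R]_n) :
  h = \sum_i h i 0 *: evec R i.
Proof.
rewrite {1}[h]matrix_sum_delta; apply: eq_bigr => i _.
by rewrite big_ord1.
Qed.

Lemma d1_sum (R : realType) (n : nat) (f : 'cV[R]_n -> R) (u h : 'cV[R]_n) :
  d1 f u h = \sum_i h i 0 * d1 f u (evec R i).
Proof.
rewrite /d1 {1}[h]sum_evec linear_sum; apply: eq_bigr => i _.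
by rewrite linearZ.
Qed.

Lemma d2_suml (R : realType) (n : nat) (f : 'cV[R]_n -> R) (u h k : 'cV[R]_n) :
  (forall l, differentiable (fun v => d1 f v l) u) ->
  d2 f u h k = \sum_i h i 0 * d2 f u (evec R i) k.
Proof.
move=> df.
have -> : d2 f u h k = 'd (\sum_i (h i 0 \*: (fun v => d1 f v (evec R i)))) u k.
  rewrite /d2; congr (('d _ u : _ -> _) k); apply/funext => v.
  by rewrite d1_sum fct_sumE.
rewrite -deriveE; last first.
  apply: differentiable_sum => i; exact: differentiableZ.
rewrite derive_sum; last by move=> i; apply: derivableZ; exact: diff_derivable.
apply: eq_bigr => i _; rewrite deriveZ; last exact: diff_derivable.
by rewrite deriveE.
Qed.

Lemma d2_sumr (R : realType) (n : nat) (f : 'cV[R]_n -> R) (u h k : 'cV[R]_n) :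
  d2 f u h k = \sum_i k i 0 * d2 f u h (evec R i).
Proof. exact: d1_sum. Qed.

Lemma cvg_between (R : realType) (T : Type) (F : set_system T) (s t : T -> R) :
  Filter F -> (forall x, 0 < s x < t x) -> t @ F --> 0 -> s @ F --> 0.
Proof.
move=> FF st t0; apply: (@squeeze_cvgr _ _ _ _ (cst 0) t) => //; last exact: cvg_cst.
by near=> x; have /andP[/ltW -> /ltW ->] := st x.
Unshelve. all: by end_near.
Qed.

(** The mean value theorem is applied in direction [h] to the difference of two parallel line
    restrictions, then in direction [k] to the resulting first derivative. *)
Lemma double_difference (R : realType) (n : nat) (f : 'cV[R]_n -> R)
    (u h k : 'cV[R]_n) (s : R) :
  (forall v, differentiable f v) ->
  (forall l v, differentiable (fun w => d1 f w l) v) ->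
  0 < s ->
  exists c : R * R, [/\ 0 < c.1 < s, 0 < c.2 < s &
    f (u + s *: h + s *: k) - f (u + s *: h) - f (u + s *: k) + f u =
    s ^+ 2 * d2 f (u + c.1 *: h + c.2 *: k) h k].
Proof.
move=> df ddf s0.
pose g (t : R) := f (u + s *: k + t *: h) - f (u + t *: h).
have dg (t : R) : is_derive t 1 g (d1 f (u + s *: k + t *: h) h - d1 f (u + t *: h) h).
  by apply: is_deriveB; apply: is_derive_line.
have [c1] := @MVT R g _ 0 s s0 (fun x _ => dg x) (is_derive_within_continuous dg).
rewrite in_itv /= subr0 => c1s gE.
pose g2 (t : R) := d1 f (u + c1 *: h + t *: k) h.
have dg2 (t : R) : is_derive t 1 g2 (d2 f (u + c1 *: h + t *: k) h k).
  exact: (@is_derive_line R n (fun v => d1 f v h)).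
have [c2] := @MVT R g2 _ 0 s s0 (fun x _ => dg2 x) (is_derive_within_continuous dg2).
rewrite in_itv /= subr0 => c2s g2E.
exists (c1, c2); split => //=.
rewrite expr2 -mulrA [X in s * X]mulrC -g2E /g2 mulrC scale0r addr0.
rewrite [u + c1 *: h + _]addrAC -gE /g !scale0r !addr0 [u + s *: k + _]addrAC; ring.
Qed.

(** The mixed second difference is symmetric in [h] and [k], so both orders of differentiation take
    the same value at two points that tend to [u]; continuity of [d2] in the base point
    concludes. *)
Lemma d2C (R : realType) (n : nat) (f : 'cV[R]_n -> R) (u h k : 'cV[R]_n) :
  C2 f -> d2 f u h k = d2 f u k h.
Proof.
move=> [df [ddf cd2]].
pose s (i : nat) : R := i.+1%:R^-1.
have s0 i : 0 < s i by rewrite invr_gt0 ltr0n.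
have scvg : s @ \oo --> 0 by exact: cvg_harmonic.
have lim (a b : 'cV[R]_n) (c : nat -> R * R) :
    (forall i, 0 < (c i).1 < s i) -> (forall i, 0 < (c i).2 < s i) ->
    d2 f (u + (c i).1 *: a + (c i).2 *: b) a b @[i --> \oo] --> d2 f u a b.
  move=> c1 c2; apply: (continuous_cvg _ (cd2 a b u)).
  rewrite -[X in _ --> X]addr0 -[X in _ --> X]addr0 -{1}(scale0r a) -(scale0r b).
  apply: cvgD; first apply: cvgD; first exact: cvg_cst.
  - by apply: cvgZr_tmp; exact: cvg_between c1 scvg.
  - by apply: cvgZr_tmp; exact: cvg_between c2 scvg.
have [c cP] := choice (fun i => double_difference u h k df ddf (s0 i)).
have [e eP] := choice (fun i => double_difference u k h df ddf (s0 i)).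
have ce : (fun i => d2 f (u + (c i).1 *: h + (c i).2 *: k) h k) =
          (fun i => d2 f (u + (e i).1 *: k + (e i).2 *: h) k h).
  apply/funext => i; have [_ _ ci] := cP i; have [_ _ ei] := eP i.
  apply: (mulfI (expf_neq0 2 (lt0r_neq0 (s0 i)))).
  by rewrite -ci -ei [u + s i *: h + _]addrAC; ring.
have l1 := lim h k c (fun i => let: And3 a _ _ := cP i in a) (fun i => let: And3 _ a _ := cP i in a).
have l2 := lim k h e (fun i => let: And3 a _ _ := eP i in a) (fun i => let: And3 _ a _ := eP i in a).
rewrite ce in l1; exact: cvg_unique l1 l2.
Qed.

Lemma cvg_sumr (R : realType) (T I : Type) (F : set_system T) (r : seq I) (P : pred I)
    (f : I -> T -> R) (l : I -> R) :
  Filter F -> (forall i, P i -> f i x @[x --> F] --> l i) ->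
  (\sum_(i <- r | P i) f i x) @[x --> F] --> \sum_(i <- r | P i) l i.
Proof. by move=> FF fl; apply: cvg_big => //; exact: add_continuous. Qed.

Lemma taylor2_cvg (R : realType) (n : nat) (f : 'cV[R]_n -> R)
    (T : Type) (F : set_system T) (t : T -> R) (h : T -> 'cV[R]_n) (u l : 'cV[R]_n) :
  ProperFilter F -> C2 f -> (forall x, 0 < t x) -> t @ F --> 0 -> h @ F --> l ->
  (f (u + t x *: h x) - f u - t x * d1 f u (h x)) / t x ^+ 2 @[x --> F]
    --> d2 f u l l / 2.
Proof.
move=> PF [df [ddf cd2]] t0 tcvg hcvg.
(* [C2] gives continuity of [d2] in the base point for fixed directions only. Expanding both slots
   in the basis separates the moving base point from the moving direction [h x]. *)
have d2E v a : d2 f v a a = \sum_i \sum_j a i 0 * (a j 0 * d2 f v (evec R i) (evec R j)).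
  rewrite d2_suml//; apply: eq_bigr => i _.
  by rewrite d2_sumr mulr_sumr.
have lag x : exists s, 0 < s < t x /\ f (u + t x *: h x) = f u + t x * d1 f u (h x) + t x ^+ 2 * (d2 f (u + s *: h x) (h x) (h x) / 2).
  pose g (r : R) := f (u + r *: h x).
  pose g1 (r : R) := d1 f (u + r *: h x) (h x).
  pose g2 (r : R) := d2 f (u + r *: h x) (h x) (h x).
  have dg (r : R) : is_derive r 1 g (g1 r) by exact: is_derive_line.
  have dg1 (r : R) : is_derive r 1 g1 (g2 r).
    exact: (@is_derive_line R n (fun v => d1 f v (h x))).
  have [s s0 sE] := taylor2_lagrange dg dg1 (t0 x).
  have u0 : u + 0 *: h x = u by rewrite scale0r addr0.
  exists s; split; first exact: s0.
  by move: sE; rewrite /g /g1 /g2 u0 => ->.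
have [s sP] := choice lag.
rewrite (_ : (fun x => _) = (fun x => d2 f (u + s x *: h x) (h x) (h x) / 2)); last first.
  apply/funext => x; have [_ ->] := sP x.
  have := lt0r_neq0 (t0 x); move: (f u) (d1 f u _) (d2 f _ _ _) (t x) => a b c r r0.
  by field.
apply: cvgMr_tmp; rewrite d2E.
rewrite (_ : (fun x => _) = (fun x => \sum_i \sum_j (h x) i 0 * ((h x) j 0 *
    d2 f (u + s x *: h x) (evec R i) (evec R j)))); last first.
  by apply/funext => x; rewrite d2E.
have hc i : h x i 0 @[x --> F] --> l i 0.
  exact: (continuous_cvg _ (@coord_continuous R n 1 i 0 l) hcvg).
apply: cvg_sumr => i _; apply: cvg_sumr => j _.
apply: cvgM; first exact: hc.
apply: cvgM; first exact: hc.
apply: (continuous_cvg _ (cd2 _ _ u)).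
rewrite -[X in _ --> X]addr0 -(scale0r l).
apply: cvgD; first exact: cvg_cst.
apply: cvgZ => //; apply: cvg_between tcvg => x.
by have [] := sP x.
Qed.

Lemma taylor2_cvg_scalar (R : realType) (f f1 f2 : R -> R)
    (T : Type) (F : set_system T) (t a : T -> R) (x l : R) :
  ProperFilter F ->
  (forall y : R, is_derive y 1 f (f1 y)) -> (forall y : R, is_derive y 1 f1 (f2 y)) ->
  continuous f2 ->
  (forall i, 0 < t i) -> t @ F --> 0 -> a @ F --> l ->
  (f (x + t i * a i) - f x - t i * (a i * f1 x)) / t i ^+ 2 @[i --> F]
    --> l ^+ 2 * f2 x / 2.
Proof.
move=> PF df df1 cf2 t0 tcvg acvg.
have line (k k1 : R -> R) (b : R) : (forall y : R, is_derive y 1 k (k1 y)) ->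
    forall r : R, is_derive r 1 (fun r => k (x + r * b)) (b * k1 (x + r * b)).
  move=> dk r.
  have dl : is_derive r 1 (fun r : R => x + r * b) b.
    by apply: is_derive_eq; rewrite /GRing.scale /=; ring.
  have := @is_derive1_comp _ k (fun r : R => x + r * b) r _ _ (dk _) dl.
  by rewrite /GRing.scale /= mulrC.
have lag i : exists s, 0 < s < t i /\
    f (x + t i * a i) = f x + t i * (a i * f1 x) + t i ^+ 2 * (a i ^+ 2 * f2 (x + s * a i) / 2).
  have dg1 (r : R) : is_derive r 1 (fun r => a i * f1 (x + r * a i)) (a i ^+ 2 * f2 (x + r * a i)).
    have := is_deriveZ (a i) (line _ _ (a i) df1 r).
    by rewrite /GRing.scale /= expr2 -mulrA.
  have [s s0 sE] := taylor2_lagrange (line _ _ (a i) df) dg1 (t0 i).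
  by exists s; split => //; rewrite sE mul0r addr0.
have [s sP] := choice lag.
rewrite (_ : (fun i => _) = (fun i => a i ^+ 2 * f2 (x + s i * a i) / 2)); last first.
  apply/funext => i; have [_ ->] := sP i; field; exact: lt0r_neq0.
apply: cvgMr_tmp; apply: cvgM; first exact: (cvgM acvg acvg).
apply: (continuous_cvg _ (cf2 x)); rewrite -[X in _ --> X]addr0.
apply: cvgD; first exact: cvg_cst.
rewrite -(mul0r l); apply: cvgM => //; apply: cvg_between tcvg => i.
by have [] := sP i.
Qed.

Lemma cos_taylor2_cvg (R : realType) (T : Type) (F : set_system T) (t a : T -> R) (x l : R) :
  ProperFilter F -> (forall i, 0 < t i) -> t @ F --> 0 -> a @ F --> l ->
  (cos (x + t i * a i) - cos x + t i * (a i * sin x)) / t i ^+ 2 @[i --> F]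
    --> - (l ^+ 2 * cos x / 2).
Proof.
move=> PF t0 tcvg acvg.
have dns (y : R) : is_derive y 1 (fun y : R => - sin y) (- cos y).
  exact: is_deriveN.
have cnc : continuous (fun y : R => - cos y).
  by move=> y; apply: cvgN; exact: continuous_cos.
have := taylor2_cvg_scalar (x := x) PF (@is_derive_cos R) dns cnc t0 tcvg acvg.
rewrite mulrN mulNr; under eq_fun do rewrite !mulrN opprK.
exact.
Qed.

Lemma sin_taylor2_cvg (R : realType) (T : Type) (F : set_system T) (t a : T -> R) (x l : R) :
  ProperFilter F -> (forall i, 0 < t i) -> t @ F --> 0 -> a @ F --> l ->
  (sin (x + t i * a i) - sin x - t i * (a i * cos x)) / t i ^+ 2 @[i --> F]
    --> - (l ^+ 2 * sin x / 2).
Proof.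
move=> PF t0 tcvg acvg.
have cns : continuous (fun y : R => - sin y).
  by move=> y; apply: cvgN; exact: continuous_sin.
have := taylor2_cvg_scalar (x := x) PF (@is_derive_sin R) (@is_derive_cos R) cns t0 tcvg acvg.
by rewrite mulrN mulNr.
Qed.

(** * Squared Euclidean norms and the operator norm *)

Lemma sqn_ge0 (R : realType) (n : nat) (v : 'cV[R]_n) : 0 <= sqn v.
Proof. by apply: sumr_ge0 => i _; exact: sqr_ge0. Qed.

Lemma sqn0 (R : realType) (n : nat) : sqn (0 : 'cV[R]_n) = 0.
Proof. by rewrite /sqn big1 // => i _; rewrite mxE expr0n. Qed.

Lemma sqn_coord (R : realType) (n : nat) (v : 'cV[R]_n) i : v i 0 ^+ 2 <= sqn v.
Proof.
rewrite /sqn (bigD1 i) //= lerDl; apply: sumr_ge0 => j _; exact: sqr_ge0.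
Qed.

Lemma sqnZ (R : realType) (n : nat) (c : R) (v : 'cV[R]_n) :
  sqn (c *: v) = c ^+ 2 * sqn v.
Proof. by rewrite /sqn mulr_sumr; apply: eq_bigr => i _; rewrite mxE exprMn. Qed.

Lemma sqn_eq0 (R : realType) (n : nat) (v : 'cV[R]_n) : sqn v = 0 -> v = 0.
Proof.
move=> v0; apply/colP => i; rewrite mxE; apply/eqP; rewrite -sqrf_eq0 eq_le sqr_ge0 andbT.
by rewrite -v0; exact: sqn_coord.
Qed.

Lemma opnormK_ub (R : realType) (d m : nat) (Kx Ky : 'M[R]_(m, d)) (u : 'cV[R]_d) :
  sqn (Kx *m u) + sqn (Ky *m u) <= opnormK Kx Ky ^+ 2 * sqn u.
Proof.
have [/sqn_eq0 ->|u0] := eqVneq (sqn u) 0.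
  by rewrite !mulmx0 !sqn0 mulr0 addr0.
have up : 0 < sqn u by rewrite lt_def u0 sqn_ge0.
set S := [set Num.sqrt (sqn (Kx *m u) + sqn (Ky *m u)) | u in [set u : 'cV[R]_d | sqn u = 1]].
(* Coordinates of a unit vector are at most 1 in absolute value, so each entry of [K *m v] is
   bounded by the l1 norm of a row. This crude bound serves only to make the supremum in [opnormK] a
   genuine one. *)
have rowb (K : 'M[R]_(m, d)) (v : 'cV[R]_d) : sqn v = 1 ->
    sqn (K *m v) <= \sum_i (\sum_j `|K i j|) ^+ 2.
  move=> v1; apply: ler_sum => i _; rewrite -[leLHS]real_normK ?num_real //.
  rewrite lerXn2r ?nnegrE ?sumr_ge0 // mxE.
  apply: (le_trans (ler_norm_sum _ _ _)); apply: ler_sum => j _.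
  rewrite normrM ler_piMr //.
  by rewrite -(@expr_le1 _ 2) // real_normK ?num_real // -v1 sqn_coord.
have Sub : has_ubound S.
  exists (Num.sqrt (\sum_i (\sum_j `|Kx i j|) ^+ 2 + \sum_i (\sum_j `|Ky i j|) ^+ 2)).
  move=> _ [v v1 <-]; rewrite ler_wsqrtr // lerD //; exact: rowb.
set c := (Num.sqrt (sqn u))^-1.
have c2 : c ^+ 2 = (sqn u)^-1 by rewrite /c exprVn sqr_sqrtr // ltW.
have cu : sqn (c *: u) = 1 by rewrite sqnZ c2 mulVf.
have : Num.sqrt (sqn (Kx *m (c *: u)) + sqn (Ky *m (c *: u))) <= opnormK Kx Ky.
  by apply: (ub_le_sup Sub); exists (c *: u).
rewrite -!scalemxAr !sqnZ -mulrDr c2 => le1.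
have sp : 0 <= sqn (Kx *m u) + sqn (Ky *m u) by rewrite addr_ge0 ?sqn_ge0.
have le0 : 0 <= (sqn u)^-1 * (sqn (Kx *m u) + sqn (Ky *m u)).
  by rewrite mulr_ge0 // invr_ge0 ltW.
have op0 : 0 <= opnormK Kx Ky by apply: le_trans le1; exact: sqrtr_ge0.
rewrite -ler_pdivrMr // mulrC -(sqr_sqrtr le0).
by rewrite lerXn2r ?nnegrE ?sqrtr_ge0.
Qed.

(** * Limits along filters and the algebra of second-order expansions *)

(** Compactness of the segment yields a cluster point [l]. For each neighbourhood of [l] the
    ultrafilter contains its preimage or the complement of that preimage, and the latter contradicts
    clustering. *)
Lemma ultra_bounded_cvg (R : realType) (T : Type) (U : set_system T) (f : T -> R) (b : R) :
  UltraFilter U -> (forall x, `|f x| <= b) -> exists l : R, f @ U --> l.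
Proof.
move=> UU fb.
have PU := ultra_proper.
have [|l [_ cl]] := @segment_compact R (- b) b (f @ U) _.
  by apply: (@filterE _ U) => x; rewrite /= in_itv /= -ler_norml; exact: fb.
exists l => A lA; have [//|Ac] := in_ultra_setVsetC (f @^-1` A) UU.
by have [y [nAy /= Ay]] := cl (~` A) A Ac lA.
Qed.

(* [X n = X0 + t_n A_n + t_n^2 (b + o(1))] along F; here b is half the second
   derivative.  It is the limit of a total quotient, so it is only meaningful
   when [t n != 0]. *)
Definition expand2 (R : realType) (T : Type) (F : set_system T)
    (t X : T -> R) (X0 : R) (A : T -> R) (b : R) : Prop :=
  (X n - X0 - t n * A n) / t n ^+ 2 @[n --> F] --> b.

Lemma expand2_linear (R : realType) (T : Type) (F : set_system T)
    (t A X : T -> R) (X0 : R) :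
  Filter F -> (forall n, X n = X0 + t n * A n) -> expand2 F t X X0 A 0.
Proof.
move=> FF XE; rewrite /expand2 (_ : (fun n => _) = cst 0); first exact: cvg_cst.
by apply/funext => n; rewrite XE [X0 + _]addrC addrK subrr mul0r.
Qed.

Lemma expand2D (R : realType) (T : Type) (F : set_system T)
    (t X Y A B : T -> R) (X0 Y0 a b : R) :
  Filter F -> expand2 F t X X0 A a -> expand2 F t Y Y0 B b ->
  expand2 F t (fun n => X n + Y n) (X0 + Y0) (fun n => A n + B n) (a + b).
Proof.
move=> FF eX eY.
rewrite /expand2 (_ : (fun n => _) = (fun n => (X n - X0 - t n * A n) / t n ^+ 2)
  + (fun n => (Y n - Y0 - t n * B n) / t n ^+ 2)).
  exact: cvgD.
by apply/funext => n /=; rewrite -[RHS]mulrDl; congr (_ / _); ring.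
Qed.

Lemma expand2Z (R : realType) (T : Type) (F : set_system T)
    (t X A : T -> R) (c X0 a : R) :
  Filter F -> expand2 F t X X0 A a ->
  expand2 F t (fun n => c * X n) (c * X0) (fun n => c * A n) (c * a).
Proof.
move=> FF eX.
rewrite /expand2 (_ : (fun n => _) = (fun n => c * ((X n - X0 - t n * A n) / t n ^+ 2))).
  exact: cvgMl_tmp.
by apply/funext => n /=; rewrite [RHS]mulrA; congr (_ / _); ring.
Qed.

Lemma expand2_sum (R : realType) (T I : Type) (F : set_system T) (r : seq I) (t : T -> R)
    (X A : I -> T -> R) (X0 a : I -> R) :
  Filter F -> (forall i, expand2 F t (X i) (X0 i) (A i) (a i)) ->
  expand2 F t (fun n => \sum_(i <- r) X i n) (\sum_(i <- r) X0 i)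
    (fun n => \sum_(i <- r) A i n) (\sum_(i <- r) a i).
Proof.
move=> FF eX; rewrite /expand2.
rewrite (_ : (fun n => _) = (fun n => \sum_(i <- r) (X i n - X0 i - t n * A i n) / t n ^+ 2)).
  by apply: cvg_sumr => i _; exact: eX.
by apply/funext => n; rewrite -mulr_suml !sumrB mulr_sumr.
Qed.

(** The term [a * b] is the product of the two first-order parts, which is of order [t ^+ 2]; it
    carries no factor 2 because the coefficients are half second derivatives. *)
Lemma expand2M (R : realType) (T : Type) (F : set_system T)
    (t X Y A B : T -> R) (X0 Y0 a b a' b' : R) :
  Filter F -> (forall n, t n != 0) -> t @ F --> 0 -> A @ F --> a -> B @ F --> b ->
  expand2 F t X X0 A a' -> expand2 F t Y Y0 B b' ->
  expand2 F t (fun n => X n * Y n) (X0 * Y0) (fun n => A n * Y0 + X0 * B n)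
    (a' * Y0 + X0 * b' + a * b).
Proof.
move=> FF t0 tcvg Aa Bb eX eY; rewrite /expand2 in eX eY *.
set C := (fun n => (X n - X0 - _) / _) in eX.
set D := (fun n => (Y n - Y0 - _) / _) in eY.
rewrite (_ : (fun n => _) = (fun n => C n * Y0 + X0 * D n + A n * B n
    + t n * (A n * D n + C n * B n + t n * (C n * D n)))).
  rewrite -[X in _ --> X]addr0 -(mul0r (a * b' + a' * b + 0 * (a' * b'))).
  apply: cvgD; [apply: cvgD; [apply: cvgD|]|apply: cvgM => //; apply: cvgD; [apply: cvgD|]].
  - exact: cvgMr_tmp.
  - exact: cvgMl_tmp.
  - exact: cvgM.
  - exact: cvgM.
  - exact: cvgM.
  - by apply: cvgM => //; exact: cvgM.
apply/funext => n.
have CE : X n = X0 + t n * A n + t n ^+ 2 * C n.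
  by rewrite /C [t n ^+ 2 * _]mulrC divfK ?expf_neq0 //; ring.
have DE : Y n = Y0 + t n * B n + t n ^+ 2 * D n.
  by rewrite /D [t n ^+ 2 * _]mulrC divfK ?expf_neq0 //; ring.
rewrite CE DE; move: (C n) (D n) (A n) (B n) (t n) (t0 n) => {CE DE} c d x y r r0.
by field.
Qed.

Lemma expand2_first (R : realType) (T : Type) (F : set_system T)
    (t X A : T -> R) (X0 a a' : R) :
  Filter F -> (forall n, t n != 0) -> t @ F --> 0 -> A @ F --> a ->
  expand2 F t X X0 A a' -> (X n - X0) / t n @[n --> F] --> a.
Proof.
move=> FF t0 tcvg Aa; rewrite /expand2; set C := (fun n => _ / _ ^+ 2) => eX.
rewrite (_ : (fun n => _) = (fun n => A n + t n * C n)).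
  by rewrite -[X in _ --> X]addr0 -(mul0r a'); apply: cvgD => //; exact: cvgM.
by apply/funext => n; rewrite /C; move: (X n) (A n) (t n) (t0 n) => x y r r0; field.
Qed.

Lemma cvg_le0 (R : realType) (T : Type) (F : set_system T) (f : T -> R) (l : R) :
  ProperFilter F -> f @ F --> l -> (\forall n \near F, f n <= 0) -> l <= 0.
Proof.
by move=> PF fl f0; exact: (@closed_cvg _ _ F PF f (fun x => x <= 0) (@closed_le R 0) f0 l fl).
Qed.

Lemma cvg_ge0 (R : realType) (T : Type) (F : set_system T) (f : T -> R) (l : R) :
  ProperFilter F -> f @ F --> l -> (\forall n \near F, 0 <= f n) -> 0 <= l.
Proof.
by move=> PF fl f0; exact: (@closed_cvg _ _ F PF f (fun x => 0 <= x) (@closed_ge R 0) f0 l fl).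
Qed.

Lemma cvg_eq0 (R : realType) (T : Type) (F : set_system T) (f : T -> R) (l : R) :
  ProperFilter F -> f @ F --> l -> (\forall n \near F, f n = 0) -> l = 0.
Proof.
move=> PF fl f0; apply/eqP; rewrite eq_le; apply/andP; split.
- by apply: (cvg_le0 PF fl); apply: filterS f0 => n ->.
- by apply: (cvg_ge0 PF fl); apply: filterS f0 => n ->.
Qed.

Lemma expand2_le0 (R : realType) (T : Type) (F : set_system T)
    (t X A : T -> R) (X0 a : R) :
  ProperFilter F -> expand2 F t X X0 A a -> (forall n, A n = 0) ->
  (\forall n \near F, X n <= X0) -> a <= 0.
Proof.
rewrite /expand2 => PF eX A0 XX0.
apply: (cvg_le0 PF eX); apply: filterS XX0 => n XX0.
by rewrite A0 mulr0 subr0 mulr_le0_ge0 ?invr_ge0 ?sqr_ge0 // subr_le0.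
Qed.

Lemma cvg_coord (R : realType) (T : Type) (F : set_system T) (n : nat)
    (h : T -> 'cV[R]_n) (l : 'cV[R]_n) (i : 'I_n) :
  Filter F -> h @ F --> l -> h x i 0 @[x --> F] --> l i 0.
Proof.
by move=> FF hl; exact: (continuous_cvg _ (@coord_continuous R n 1 i 0 l) hl).
Qed.

Lemma cvg_d1 (R : realType) (T : Type) (F : set_system T) (n : nat)
    (f : 'cV[R]_n -> R) (u : 'cV[R]_n) (h : T -> 'cV[R]_n) (l : 'cV[R]_n) :
  Filter F -> h @ F --> l -> d1 f u (h x) @[x --> F] --> d1 f u l.
Proof.
move=> FF hl; rewrite d1_sum; under eq_cvg do rewrite d1_sum.
by apply: cvg_sumr => i _; apply: cvgMr_tmp; exact: cvg_coord.
Qed.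

Lemma cvg_mulmx (R : realType) (T : Type) (F : set_system T) (m n : nat)
    (K : 'M[R]_(m, n)) (h : T -> 'cV[R]_n) (l : 'cV[R]_n) (i : 'I_m) :
  Filter F -> h @ F --> l -> (K *m h x) i 0 @[x --> F] --> (K *m l) i 0.
Proof.
move=> FF hl; rewrite mxE; under eq_cvg do rewrite mxE.
by apply: cvg_sumr => j _; apply: cvgMl_tmp; exact: cvg_coord.
Qed.

Lemma gQE (R : realType) (m k : nat) (Q : 'cV[R]_k -> 'cV[R]_m) a i da :
  gQ Q a i da = d1 (Qc Q i) a da.
Proof.
by rewrite d1_sum /gQ /dotv; apply: eq_bigr => j _; rewrite mxE mulrC.
Qed.

(** Makes the second-order expansions applicable to components of the gradient of [Df]; this is how
    the third derivative enters the Hessian of the Lagrangian. *)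
Lemma C3_C2_d1 (R : realType) (n : nat) (f : 'cV[R]_n -> R) (h : 'cV[R]_n) :
  C3 f -> C2 (fun v => d1 f v h).
Proof. by move=> [_ [df [ddf cf]]]; split; [exact: df|split; [exact: ddf|exact: cf]]. Qed.

Lemma C3_C2 (R : realType) (n : nat) (f : 'cV[R]_n -> R) : C3 f -> C2 f.
Proof.
move=> [df [ddf [dddf _]]]; split; [exact: df|split; [exact: ddf|]].
by move=> h k u; exact: differentiable_continuous.
Qed.

(** Turns a constraint into its linearisation at the limit direction: the same quantity is expanded
    once exactly, through the affine side of the equation, and once through the nonlinear side. *)
Lemma expand2_first_unique (R : realType) (T : Type) (F : set_system T)
    (t X a A : T -> R) (X0 l l' b : R) :
  ProperFilter F -> (forall n, t n != 0) -> t @ F --> 0 ->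
  (forall n, X n = X0 + t n * a n) -> a @ F --> l ->
  expand2 F t X X0 A b -> A @ F --> l' -> l = l'.
Proof.
move=> PF t0 tcvg XE al eX Al.
have al' : (X n - X0) / t n @[n --> F] --> l' by exact: expand2_first Al eX.
have aE : (fun n => (X n - X0) / t n) = a.
  by apply/funext => n; rewrite XE [X0 + _]addrC addrK mulrC mulKf.
by rewrite aE in al'; exact: cvg_unique al al'.
Qed.

(** Product rule for a radius times the cosine of an angle. The last term, radius increment times
    angle increment, is the source of the cross terms in [lagrangian_hess]; the leading [0] is the
    second-order coefficient of the affine radius. *)
Lemma expand2_polar_cos (R : realType) (T : Type) (F : set_system T)
    (t a b : T -> R) (x y a' b' : R) :
  ProperFilter F -> (forall n, 0 < t n) -> t @ F --> 0 -> a @ F --> a' -> b @ F --> b' ->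
  expand2 F t (fun n => (x + t n * a n) * cos (y + t n * b n)) (x * cos y)
    (fun n => a n * cos y + x * - (b n * sin y))
    (0 * cos y + x * - (b' ^+ 2 * cos y / 2) + a' * - (b' * sin y)).
Proof.
move=> PF t0 tcvg aa bb; apply: expand2M => //.
- by move=> n; rewrite gt_eqF.
- by apply: cvgN; exact: cvgMr_tmp.
- exact: expand2_linear.
- rewrite /expand2; under eq_cvg do rewrite mulrN opprK.
  exact: cos_taylor2_cvg.
Qed.

Lemma expand2_polar_sin (R : realType) (T : Type) (F : set_system T)
    (t a b : T -> R) (x y a' b' : R) :
  ProperFilter F -> (forall n, 0 < t n) -> t @ F --> 0 -> a @ F --> a' -> b @ F --> b' ->
  expand2 F t (fun n => (x + t n * a n) * sin (y + t n * b n)) (x * sin y)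
    (fun n => a n * sin y + x * (b n * cos y))
    (0 * sin y + x * - (b' ^+ 2 * sin y / 2) + a' * (b' * cos y)).
Proof.
move=> PF t0 tcvg aa bb; apply: expand2M => //.
- by move=> n; rewrite gt_eqF.
- exact: cvgMr_tmp.
- exact: expand2_linear.
- exact: sin_taylor2_cvg.
Qed.

Lemma mulmx_step (R : realType) (m n : nat) (K : 'M[R]_(m, n)) (u h : 'cV[R]_n) (t : R) i :
  (K *m (u + t *: h)) i 0 = (K *m u) i 0 + t * (K *m h) i 0.
Proof. by rewrite mulmxDr -scalemxAr mxE [X in _ + X]mxE. Qed.

Lemma coord_step (R : realType) (n : nat) (u h : 'cV[R]_n) (t : R) i :
  (u + t *: h) i 0 = u i 0 + t * h i 0.
Proof. by rewrite !mxE. Qed.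

(** * Feasible sequences and the critical cone *)

Definition tvstep (R : realType) (d m k : nat) (x : tvpoint R d m k) (t : R)
    (D : tvpoint R d m k) : tvpoint R d m k :=
  TVPoint (xu x + t *: xu D) (xqx x + t *: xqx D) (xqy x + t *: xqy D)
    (xal x + t *: xal D) (xr x + t *: xr D) (xdel x + t *: xdel D) (xth x + t *: xth D).

(** [tvpoint] is a bare record without topology, hence one limit per component. *)
Record tvcvg (R : realType) (d m k : nat) (T : Type) (F : set_system T)
    (D : T -> tvpoint R d m k) (dd : tvpoint R d m k) : Prop := TVCvg {
  cvg_xu : xu (D n) @[n --> F] --> xu dd;
  cvg_xqx : xqx (D n) @[n --> F] --> xqx dd;
  cvg_xqy : xqy (D n) @[n --> F] --> xqy dd;
  cvg_xal : xal (D n) @[n --> F] --> xal dd;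
  cvg_xr : xr (D n) @[n --> F] --> xr dd;
  cvg_xdel : xdel (D n) @[n --> F] --> xdel dd;
  cvg_xth : xth (D n) @[n --> F] --> xth dd }.

Lemma feasible_index (R : realType) (d m k : nat) (Kx Ky : 'M[R]_(m, d))
    (Df : 'cV[R]_d -> R) (Q : 'cV[R]_k -> 'cV[R]_m) (x : tvpoint R d m k) (i : 'I_m) :
  feasible Kx Ky Df Q x -> [|| inA Q x i, inI Q x i | inB Q x i].
Proof.
move=> [_ [_ [_ [_ [_ /(_ i)[r0 [Qd0 rQ]]]]]]]; rewrite /inA /inI /inB.
move: rQ => /eqP; rewrite mulf_eq0 => /orP[/eqP r_0|Qd].
  by rewrite r_0 eqxx ltxx /= lt_def -subr_ge0 Qd0 andbT orNb.
by move: Qd; rewrite subr_eq0 => ->; rewrite !andbT [0 < xr x i 0]lt_def r0 andbT orNb orbT.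
Qed.

(** A strict inequality at [xs] persists nearby by continuity, and complementarity then forces the
    other factor to vanish. On [inB] neither factor is strictly positive, so nothing is claimed
    there. *)
Lemma feasible_near (R : realType) (d m k : nat) (Kx Ky : 'M[R]_(m, d))
    (Df : 'cV[R]_d -> R) (Q : 'cV[R]_k -> 'cV[R]_m) (xs dd : tvpoint R d m k)
    (T : Type) (F : set_system T) (t : T -> R) (D : T -> tvpoint R d m k) :
  ProperFilter F -> (forall i, C2 (Qc Q i)) -> t @ F --> 0 -> tvcvg F D dd ->
  (forall n, feasible Kx Ky Df Q (tvstep xs (t n) (D n))) ->
  \forall n \near F, forall i : 'I_m,
    (inA Q xs i -> xr (tvstep xs (t n) (D n)) i 0 = 0) /\
    (inI Q xs i -> Q (xal (tvstep xs (t n) (D n))) i 0 = xdel (tvstep xs (t n) (D n)) i 0).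
Proof.
move=> PF CQ tcvg Dcvg feas; apply: filter_forall => i.
have coordcvg (v : 'cV[R]_m) (h : T -> 'cV[R]_m) (l : 'cV[R]_m) : h @ F --> l ->
    (v + t n *: h n) i 0 @[n --> F] --> v i 0.
  move=> hl; rewrite -[X in _ --> X]addr0 -(mul0r (l i 0)); under eq_cvg do rewrite coord_step.
  apply: cvgD; first exact: cvg_cst.
  by apply: cvgM => //; exact: cvg_coord.
have rcvg := coordcvg (xr xs) _ _ (cvg_xr Dcvg).
have dcvg := coordcvg (xdel xs) _ _ (cvg_xdel Dcvg).
have Qcvg : Q (xal xs + t n *: xal (D n)) i 0 @[n --> F] --> Q (xal xs) i 0.
  have cQ : {for xal xs, continuous (Qc Q i)}.
    by apply: differentiable_continuous; have [] := CQ i.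
  apply: (@continuous_cvg T _ _ F _ (fun n => xal xs + t n *: xal (D n)) (Qc Q i) _ cQ); rewrite -[X in _ --> X]addr0 -(scale0r (xal dd)).
  apply: cvgD; first exact: cvg_cst.
  by apply: cvgZ => //; exact: cvg_xal.
have [iA|iA] := boolP (inA Q xs i); last have [iI|iI] := boolP (inI Q xs i).
- have Qd : 0 < Q (xal xs) i 0 - xdel xs i 0.
    by move: iA => /andP[_]; rewrite subr_gt0.
  have near0 : \forall n \near F,
      0 < Q (xal xs + t n *: xal (D n)) i 0 - (xdel xs + t n *: xdel (D n)) i 0.
    exact: (cvgr_gt _ (cvgB Qcvg dcvg) _ Qd).
  apply: filterS near0 => n /= Qdn; split => [_|/andP[]].
    have [_ [_ [_ [_ [_ /(_ i) [_ [_ /eqP]]]]]]] := feas n.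
    by rewrite mulf_eq0 => /orP[/eqP //|/eqP]; move: Qdn => /[swap] /= ->; rewrite ltxx.
  by move: iA => /andP[/eqP ->]; rewrite ltxx.
- have r0 : 0 < xr xs i 0 by move: iI => /andP[].
  have near0 : \forall n \near F, 0 < (xr xs + t n *: xr (D n)) i 0.
    exact: (cvgr_gt _ rcvg _ r0).
  apply: filterS near0 => n /= rn; split => // _.
  have [_ [_ [_ [_ [_ /(_ i) [_ [_ /eqP]]]]]]] := feas n.
  by rewrite mulf_eq0 => /orP[|]; [rewrite gt_eqF|rewrite subr_eq0 => /eqP].
- by apply: filterE.
Qed.

Lemma feasible_grad (R : realType) (d m k : nat) (Kx Ky : 'M[R]_(m, d))
    (Df : 'cV[R]_d -> R) (Q : 'cV[R]_k -> 'cV[R]_m) (z : tvpoint R d m k) (j : 'I_d) :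
  feasible Kx Ky Df Q z ->
  d1 Df (xu z) (evec R j) + (Kx^T *m xqx z) j 0 + (Ky^T *m xqy z) j 0 = 0.
Proof.
move=> [/(congr1 (fun v : 'cV[R]_d => v j 0)) + _].
have addE (A B C : 'cV[R]_d) : (A + B + C) j 0 = A j 0 + B j 0 + C j 0 by rewrite !mxE.
by rewrite addE [grad _ _ _ _]mxE [in RHS]mxE.
Qed.

(** Each relation of the cone is the limit of the difference quotient of one constraint, or of the
    inequality for [J]; equalities and weak inequalities survive the limit. *)
Lemma limit_critical (R : realType) (d m k : nat) (Kx Ky : 'M[R]_(m, d))
    (Df J : 'cV[R]_d -> R) (Q : 'cV[R]_k -> 'cV[R]_m) (xs dd : tvpoint R d m k)
    (T : Type) (F : set_system T) (t : T -> R) (D : T -> tvpoint R d m k) :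
  ProperFilter F -> C3 Df -> C2 J -> (forall i, C2 (Qc Q i)) ->
  (forall n, 0 < t n) -> t @ F --> 0 -> tvcvg F D dd ->
  feasible Kx Ky Df Q xs ->
  (forall n, feasible Kx Ky Df Q (tvstep xs (t n) (D n))) ->
  (forall n, J (xu (tvstep xs (t n) (D n))) <= J (xu xs)) ->
  critical Kx Ky Df J Q xs dd.
Proof.
move=> PF CD CJ CQ t0 tcvg Dcvg feas feasn Jle.
have FF : Filter F by exact: _.
have tn0 n : t n != 0 by rewrite gt_eqF.
have near_c := feasible_near PF CQ tcvg Dcvg feasn.
have [cu cqx cqy cal cr cdel cth] := Dcvg.
have [opt [kin [pol [Q0 [del0 com]]]]] := feas.
have Qfirst i : (Q (xal xs + t n *: xal (D n)) i 0 - Q (xal xs) i 0) / t n @[n --> F]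
    --> gQ Q (xal xs) i (xal dd).
  rewrite gQE; apply: (expand2_first FF tn0 tcvg (cvg_d1 FF cal)).
  exact: (taylor2_cvg PF (CQ i) t0 tcvg cal).
have delfirst i := cvg_coord (i := i) FF cdel.
have rfirst i := cvg_coord (i := i) FF cr.
have gapfirst i : (Q (xal xs + t n *: xal (D n)) i 0 - Q (xal xs) i 0) / t n - xdel (D n) i 0
    @[n --> F] --> gQ Q (xal xs) i (xal dd) - xdel dd i 0.
  exact: (cvgB (Qfirst i) (delfirst i)).
refine (conj _ (conj _ (conj _ (conj _ (conj _ (conj _ (conj _ (conj _ (conj _ (conj _ _)))))))))).
- have Jfirst : (J (xu xs + t n *: xu (D n)) - J (xu xs)) / t n @[n --> F] --> d1 J (xu xs) (xu dd).
    apply: (expand2_first FF tn0 tcvg (cvg_d1 FF cu)).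
    exact: (taylor2_cvg PF CJ t0 tcvg cu).
  apply: (cvg_le0 PF Jfirst); apply: filterE => n.
  by rewrite ler_pdivrMr // mul0r subr_le0; exact: Jle.
- apply/colP => j; rewrite !mxE.
  (* The optimality equation is affine in q, so the increment of the gradient of [Df] is known
     exactly from the increments of q. Its limit is then compared with the Taylor expansion of the
     gradient component. *)
  pose a n := - (Kx^T *m xqx (D n)) j 0 - (Ky^T *m xqy (D n)) j 0.
  have aE n : d1 Df (xu xs + t n *: xu (D n)) (evec R j) = d1 Df (xu xs) (evec R j) + t n * a n.
    have := feasible_grad j (feasn n); rewrite /= !mulmx_step.
    have := feasible_grad j feas; rewrite /a.
    move: (d1 _ _ _) (d1 _ _ _) => p q; lra.
  have := expand2_first_unique PF tn0 tcvg aE _ (taylor2_cvg PF (C3_C2_d1 (evec R j) CD) t0 tcvg cu) (cvg_d1 FF cu).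
  move=> /(_ (- (Kx^T *m xqx dd) j 0 - (Ky^T *m xqy dd) j 0)) first.
  have {}first : - (Kx^T *m xqx dd) j 0 - (Ky^T *m xqy dd) j 0 = d2 Df (xu xs) (evec R j) (xu dd).
    by apply: first; apply: cvgB; [apply: cvgN|]; exact: cvg_mulmx.
  by move: first; rewrite !mxE; lra.
- move=> i.
  have KE n : (xr xs i 0 + t n * xr (D n) i 0) * cos (xth xs i 0 + t n * xth (D n) i 0)
      = xr xs i 0 * cos (xth xs i 0) + t n * (Kx *m xu (D n)) i 0.
    have [_ [/(_ i)[kx _] _]] := feasn n; have [kx0 _] := kin i.
    by move: kx; rewrite /= mulmx_step !coord_step kx0.
  have := expand2_first_unique PF tn0 tcvg KE (cvg_mulmx (i := i) FF cu)
    (expand2_polar_cos PF t0 tcvg (cvg_coord (i := i) FF cr) (cvg_coord (i := i) FF cth)).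
  have l : (fun n => xr (D n) i 0 * cos (xth xs i 0) + xr xs i 0 * - (xth (D n) i 0 * sin (xth xs i 0))) @ F
     --> xr dd i 0 * cos (xth xs i 0) + xr xs i 0 * - (xth dd i 0 * sin (xth xs i 0)).
    apply: cvgD; first by apply: cvgMr_tmp; exact: cvg_coord.
    by apply: cvgMl_tmp; apply: cvgN; apply: cvgMr_tmp; exact: cvg_coord.
  by move=> /(_ _ l) ->; ring.
- move=> i.
  have KE n : (xr xs i 0 + t n * xr (D n) i 0) * sin (xth xs i 0 + t n * xth (D n) i 0)
      = xr xs i 0 * sin (xth xs i 0) + t n * (Ky *m xu (D n)) i 0.
    have [_ [/(_ i)[_ ky] _]] := feasn n; have [_ ky0] := kin i.
    by move: ky; rewrite /= mulmx_step !coord_step ky0.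
  have := expand2_first_unique PF tn0 tcvg KE (cvg_mulmx (i := i) FF cu)
    (expand2_polar_sin PF t0 tcvg (cvg_coord (i := i) FF cr) (cvg_coord (i := i) FF cth)).
  have l : (fun n => xr (D n) i 0 * sin (xth xs i 0) + xr xs i 0 * (xth (D n) i 0 * cos (xth xs i 0))) @ F
     --> xr dd i 0 * sin (xth xs i 0) + xr xs i 0 * (xth dd i 0 * cos (xth xs i 0)).
    apply: cvgD; first by apply: cvgMr_tmp; exact: cvg_coord.
    by apply: cvgMl_tmp; apply: cvgMr_tmp; exact: cvg_coord.
  by move=> /(_ _ l) ->; ring.
- move=> i.
  have KE n : (xdel xs i 0 + t n * xdel (D n) i 0) * cos (xth xs i 0 + t n * xth (D n) i 0)
      = xdel xs i 0 * cos (xth xs i 0) + t n * xqx (D n) i 0.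
    have [_ [_ [/(_ i)[kx _] _]]] := feasn n; have [kx0 _] := pol i.
    by move: kx; rewrite /= !coord_step kx0.
  have := expand2_first_unique PF tn0 tcvg KE (cvg_coord (i := i) FF cqx)
    (expand2_polar_cos PF t0 tcvg (cvg_coord (i := i) FF cdel) (cvg_coord (i := i) FF cth)).
  have l : (fun n => xdel (D n) i 0 * cos (xth xs i 0) + xdel xs i 0 * - (xth (D n) i 0 * sin (xth xs i 0))) @ F
     --> xdel dd i 0 * cos (xth xs i 0) + xdel xs i 0 * - (xth dd i 0 * sin (xth xs i 0)).
    apply: cvgD; first by apply: cvgMr_tmp; exact: cvg_coord.
    by apply: cvgMl_tmp; apply: cvgN; apply: cvgMr_tmp; exact: cvg_coord.
  by move=> /(_ _ l) ->; ring.
- move=> i.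
  have KE n : (xdel xs i 0 + t n * xdel (D n) i 0) * sin (xth xs i 0 + t n * xth (D n) i 0)
      = xdel xs i 0 * sin (xth xs i 0) + t n * xqy (D n) i 0.
    have [_ [_ [/(_ i)[_ ky] _]]] := feasn n; have [_ ky0] := pol i.
    by move: ky; rewrite /= !coord_step ky0.
  have := expand2_first_unique PF tn0 tcvg KE (cvg_coord (i := i) FF cqy)
    (expand2_polar_sin PF t0 tcvg (cvg_coord (i := i) FF cdel) (cvg_coord (i := i) FF cth)).
  have l : (fun n => xdel (D n) i 0 * sin (xth xs i 0) + xdel xs i 0 * (xth (D n) i 0 * cos (xth xs i 0))) @ F
     --> xdel dd i 0 * sin (xth xs i 0) + xdel xs i 0 * (xth dd i 0 * cos (xth xs i 0)).
    apply: cvgD; first by apply: cvgMr_tmp; exact: cvg_coord.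
    by apply: cvgMl_tmp; apply: cvgMr_tmp; exact: cvg_coord.
  by move=> /(_ _ l) ->; ring.
- move=> i Qi0; apply: (cvg_ge0 PF (Qfirst i)); apply: filterE => n.
  rewrite Qi0 subr0; apply: divr_ge0; last exact: ltW.
  by have [_ [_ [_ [/(_ i) Qn _]]]] := feasn n.
- move=> i di0; apply: (cvg_ge0 PF (delfirst i)); apply: filterE => n.
  have [_ [_ [_ [_ [/(_ i) + _]]]]] := feasn n.
  by rewrite /= coord_step di0 add0r pmulr_rge0.
- move=> i iI; apply/eqP; rewrite -subr_eq0; apply/eqP.
  apply: (cvg_eq0 PF (gapfirst i)); apply: filterS near_c => n /(_ i)[_ /(_ iI)] /=.
  move: iI => /andP[_ /eqP Qd] ->; rewrite Qd coord_step [_ + t n * _]addrC addrK.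
  by rewrite mulrC mulKf // subrr.
- move=> i iA; apply: (cvg_eq0 PF (rfirst i)); apply: filterS near_c => n /(_ i)[/(_ iA) + _] /=.
  move: iA => /andP[/eqP r0 _]; rewrite coord_step r0 add0r => /eqP.
  by rewrite mulf_eq0 (negbTE (tn0 n)) => /eqP.
- move=> i iB.
  have [r0 Qd] : xr xs i 0 = 0 /\ Q (xal xs) i 0 = xdel xs i 0.
    by move: iB => /andP[/eqP ? /eqP].
  (* As [Q] and [xdel] agree at [xs] for this index, the difference of the two quotients is the gap
     of the feasible point divided by [t n]. The sign of the gap and its complementarity with [xr]
     thus pass to the limit. *)
  have gapE n : (Q (xal xs + t n *: xal (D n)) i 0 - Q (xal xs) i 0) / t n - xdel (D n) i 0
      = (Q (xal xs + t n *: xal (D n)) i 0 - (xdel xs + t n *: xdel (D n)) i 0) / t n.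
    by rewrite Qd coord_step 2!mulrBl mulrDl [t n * _]mulrC mulfK // opprD addrA.
  split; last split.
  + apply: (cvg_ge0 PF (gapfirst i)); apply: filterE => n /=.
    rewrite gapE; apply: divr_ge0; last exact: ltW.
    by have [_ [_ [_ [_ [_ /(_ i)[_ [+ _]]]]]]] := feasn n.
  + apply: (cvg_ge0 PF (rfirst i)); apply: filterE => n.
    have [_ [_ [_ [_ [_ /(_ i)[+ _]]]]]] := feasn n.
    by rewrite /= coord_step r0 add0r pmulr_rge0.
  + apply: (cvg_eq0 PF (cvgM (gapfirst i) (rfirst i))); apply: filterE => n /=.
    have [_ [_ [_ [_ [_ /(_ i)[_ [_ +]]]]]]] := feasn n.
    rewrite /= gapE [X in X * _ = 0]coord_step r0 add0r => /eqP.
    rewrite !mulf_eq0 (negbTE (tn0 n)) /= => /orP[/eqP ->|/eqP ->]; by rewrite ?mul0r ?mulr0.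
Qed.

(** * The Lagrangian and the sign of its second derivative *)

Lemma sum_adjoint (R : realType) (m n : nat) (K : 'M[R]_(m, n)) (h : 'cV[R]_n) (q : 'cV[R]_m) :
  \sum_j h j 0 * (K^T *m q) j 0 = \sum_i q i 0 * (K *m h) i 0.
Proof.
under eq_bigr do rewrite mxE mulr_sumr.
rewrite exchange_big /=; apply: eq_bigr => i _; rewrite mxE mulr_sumr.
by apply: eq_bigr => j _; rewrite mxE; ring.
Qed.

(* The terms in q are absent: [- p . (K^T q)] and [lambda . q] cancel because
   [lambda = K p]. *)
Definition lagrangian (R : realType) (d m k : nat) (Kx Ky : 'M[R]_(m, d))
    (Df J : 'cV[R]_d -> R) (Q : 'cV[R]_k -> 'cV[R]_m) (y : tvmult R d m)
    (z : tvpoint R d m k) : R :=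
  J (xu z) + (-1 * d1 Df (xu z) (mp y)
  + (-1 * \sum_i (mphx y i 0 * (Kx *m xu z) i 0 + mphy y i 0 * (Ky *m xu z) i 0)
  + (-1 * \sum_i (mrho y i 0 + mnu y i 0) * Q (xal z) i 0
  + \sum_i ((mphx y i 0 * xr z i 0 - mlx y i 0 * xdel z i 0) * cos (xth z i 0)
           + ((mphy y i 0 * xr z i 0 - mly y i 0 * xdel z i 0) * sin (xth z i 0)
           + ((mnu y i 0 - msig y i 0) * xdel z i 0 - mgam y i 0 * xr z i 0)))))).

(* The second derivative at xs of the Lagrangian in direction dd, simplified
   with [r * gamma = 0] and [delta * sigma = 0]. *)
Definition lagrangian_hess (R : realType) (d m k : nat)
    (Df J : 'cV[R]_d -> R) (Q : 'cV[R]_k -> 'cV[R]_m) (xs : tvpoint R d m k)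
    (y : tvmult R d m) (dd : tvpoint R d m k) : R :=
  d2 J (xu xs) (xu dd) (xu dd) - d3 Df (xu xs) (mp y) (xu dd) (xu dd)
  - \sum_i (mrho y i 0 + mnu y i 0) * d2 (Qc Q i) (xal xs) (xal dd) (xal dd)
  + \sum_i (2 * (cos (xth xs i 0) * mphy y i 0 - sin (xth xs i 0) * mphx y i 0)
              * xr dd i 0 * xth dd i 0
            - 2 * (cos (xth xs i 0) * mly y i 0 - sin (xth xs i 0) * mlx y i 0)
              * xdel dd i 0 * xth dd i 0
            + xdel xs i 0 * mnu y i 0 * xth dd i 0 ^+ 2).

(** The optimality equation tested with [mp y] turns the gradient term into the pairing of lambda
    with q, which the polar form of q cancels; the polar form of K u cancels the phi terms. Only the
    multipliers of the inequalities and of the complementarity remain. *)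
Lemma lagrangian_feasible (R : realType) (d m k : nat) (Kx Ky : 'M[R]_(m, d))
    (Df J : 'cV[R]_d -> R) (Q : 'cV[R]_k -> 'cV[R]_m) (y : tvmult R d m)
    (z : tvpoint R d m k) :
  mlx y = Kx *m mp y -> mly y = Ky *m mp y -> feasible Kx Ky Df Q z ->
  lagrangian Kx Ky Df J Q y z = J (xu z) -
    \sum_i (mgam y i 0 * xr z i 0 + msig y i 0 * xdel z i 0 + mrho y i 0 * Q (xal z) i 0
            + mnu y i 0 * (Q (xal z) i 0 - xdel z i 0)).
Proof.
move=> lx ly feas; have [_ [kin [pol _]]] := feas.
have dE : d1 Df (xu z) (mp y) =
    - \sum_i (xqx z i 0 * mlx y i 0 + xqy z i 0 * mly y i 0).
  rewrite d1_sum big_split /= lx ly -(sum_adjoint Kx) -(sum_adjoint Ky) -big_split /= -sumrN.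
  apply: eq_bigr => j _; have /eqP := feasible_grad j feas.
  by rewrite -addrA addr_eq0 => /eqP ->; ring.
rewrite /lagrangian dE; congr (_ + _); rewrite !mulN1r opprK -!sumrN -!big_split /=.
apply: eq_bigr => i _; have [-> ->] := kin i; have [-> ->] := pol i; ring.
Qed.

(** This is the u-equation of stationarity tested with [h]. Symmetry of [d2] is essential: [hessmul]
    has the adjoint state in the second slot, whereas differentiating [d1 Df v (mp y)] puts it in
    the first. *)
Lemma stationary_first_order (R : realType) (d m k : nat) (Kx Ky : 'M[R]_(m, d))
    (Df J : 'cV[R]_d -> R) (Q : 'cV[R]_k -> 'cV[R]_m) (xs : tvpoint R d m k)
    (y : tvmult R d m) (h : 'cV[R]_d) :
  C2 Df -> Mstat Kx Ky Df J Q xs y ->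
  d1 J (xu xs) h = d2 Df (xu xs) (mp y) h
    + \sum_i (mphx y i 0 * (Kx *m h) i 0 + mphy y i 0 * (Ky *m h) i 0).
Proof.
move=> CD [st _]; rewrite (d2C _ _ _ CD) d1_sum d2_suml; last by have [_ []] := CD.
rewrite big_split /= -(sum_adjoint Kx) -(sum_adjoint Ky) -!big_split /=; apply: eq_bigr => j _.
move: st => /(congr1 (fun v : 'cV[R]_d => v j 0)).
have addE (A B C D : 'cV[R]_d) : (A - B - C - D) j 0 = A j 0 - B j 0 - C j 0 - D j 0.
  by rewrite !mxE.
have gE : grad J (xu xs) j 0 = d1 J (xu xs) (evec R j) by rewrite mxE.
have hE : hessmul Df (xu xs) (mp y) j 0 = d2 Df (xu xs) (evec R j) (mp y) by rewrite mxE.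
rewrite addE gE hE [(0 : 'cV[R]_d) j 0]mxE => /eqP.
by rewrite !subr_eq add0r => /eqP ->; ring.
Qed.

Lemma stationary_alpha (R : realType) (m k : nat) (Q : 'cV[R]_k -> 'cV[R]_m)
    (a h : 'cV[R]_k) (w : 'cV[R]_m) :
  JQt Q a *m w = 0 -> \sum_i w i 0 * d1 (Qc Q i) a h = 0.
Proof.
move=> st; under eq_bigr do rewrite d1_sum mulr_sumr.
rewrite exchange_big /= big1 // => j _.
move: st => /(congr1 (fun v : 'cV[R]_k => v j 0)); rewrite !mxE => st.
transitivity (h j 0 * \sum_l JQt Q a j l * w l 0); last by rewrite st mulr0.
rewrite mulr_sumr; apply: eq_bigr => i _.
by rewrite mxE; ring.
Qed.

Lemma lagrangian_hess_le0 (R : realType) (d m k : nat) (Kx Ky : 'M[R]_(m, d))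
    (Df J : 'cV[R]_d -> R) (Q : 'cV[R]_k -> 'cV[R]_m) (xs dd : tvpoint R d m k)
    (y : tvmult R d m)
    (T : Type) (F : set_system T) (t : T -> R) (D : T -> tvpoint R d m k) :
  ProperFilter F -> C3 Df -> C2 J -> (forall i, C2 (Qc Q i)) ->
  (forall n, 0 < t n) -> t @ F --> 0 -> tvcvg F D dd ->
  feasible Kx Ky Df Q xs ->
  (forall n, feasible Kx Ky Df Q (tvstep xs (t n) (D n))) ->
  (forall n, J (xu (tvstep xs (t n) (D n))) <= J (xu xs)) ->
  Mstat Kx Ky Df J Q xs y ->
  (forall i, inB Q xs i -> 0 <= mgam y i 0 /\ 0 <= mnu y i 0) ->
  lagrangian_hess Df J Q xs y dd <= 0.
Proof.
move=> PF CD CJ CQ t0 tcvg Dcvg feas feasn Jle MS SS.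
have FF : Filter F by exact: _.
have near_c := feasible_near PF CQ tcvg Dcvg feasn.
have [cu _ _ cal cr cdel cth] := Dcvg.
have [st1 [st2 [lx [ly [st3 [st4 [st5 [st6 [st7 [st8 [st9 _]]]]]]]]]]] := MS.
(* Complementarity of the point with gamma, and below with nu: on each index set one of the two
   factors is zero. *)
have rg i : xr xs i 0 * mgam y i 0 = 0.
  have := feasible_index i feas => /or3P[/andP[/eqP -> _]|iI|/andP[/eqP -> _]]; rewrite ?mul0r //.
  by rewrite st9 ?mulr0.
have Qn i : mnu y i 0 * (Q (xal xs) i 0 - xdel xs i 0) = 0.
  have := feasible_index i feas => /or3P[iA|/andP[_ /eqP ->]|/andP[_ /eqP ->]]; rewrite ?subrr ?mulr0 //.
  by rewrite st8 ?mul0r.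
have e1 := taylor2_cvg PF CJ t0 tcvg cu (u := xu xs).
have e2 := taylor2_cvg PF (C3_C2_d1 (mp y) CD) t0 tcvg cu (u := xu xs).
have e3 : expand2 F t (fun n => \sum_i (mphx y i 0 * (Kx *m (xu xs + t n *: xu (D n))) i 0
      + mphy y i 0 * (Ky *m (xu xs + t n *: xu (D n))) i 0))
    (\sum_i (mphx y i 0 * (Kx *m xu xs) i 0 + mphy y i 0 * (Ky *m xu xs) i 0))
    (fun n => \sum_i (mphx y i 0 * (Kx *m xu (D n)) i 0 + mphy y i 0 * (Ky *m xu (D n)) i 0))
    (\sum_(i < m) 0).
  apply: expand2_sum => i; apply: expand2_linear => n; rewrite !mulmx_step; ring.
have e4 := expand2_sum (r := index_enum 'I_m) FF (fun i => expand2Z (c := mrho y i 0 + mnu y i 0) FF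
  (taylor2_cvg PF (CQ i) t0 tcvg cal (u := xal xs))).
have cvgl (a b : R) i : a * xr (D n) i 0 - b * xdel (D n) i 0 @[n --> F] -->
    a * xr dd i 0 - b * xdel dd i 0.
  by apply: cvgB; apply: cvgMl_tmp; exact: cvg_coord.
have e5 := expand2_sum (r := index_enum 'I_m) FF (fun i =>
  expand2D FF (expand2_polar_cos (x := mphx y i 0 * xr xs i 0 - mlx y i 0 * xdel xs i 0)
     (y := xth xs i 0) PF t0 tcvg (cvgl (mphx y i 0) (mlx y i 0) i) (cvg_coord (i := i) FF cth))
  (expand2D FF (expand2_polar_sin (x := mphy y i 0 * xr xs i 0 - mly y i 0 * xdel xs i 0)
     (y := xth xs i 0) PF t0 tcvg (cvgl (mphy y i 0) (mly y i 0) i) (cvg_coord (i := i) FF cth))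
   (expand2_linear (t := t) (A := fun n => (mnu y i 0 - msig y i 0) * xdel (D n) i 0 - mgam y i 0 * xr (D n) i 0)
    (X0 := (mnu y i 0 - msig y i 0) * xdel xs i 0 - mgam y i 0 * xr xs i 0) FF (fun n => erefl _)))).
have e := expand2D FF e1 (expand2D FF (expand2Z (c := -1) FF e2) (expand2D FF (expand2Z (c := -1) FF e3)
  (expand2D FF (expand2Z (c := -1) FF e4) e5))).
refine (_ (expand2_le0 PF e _ _)) => [b0|n|].
(* [expand2] records half the second derivative, hence the doubling before the comparison with
   [lagrangian_hess]. *)
- rewrite -(pmulr_rle0 _ (ltr0n _ 2)) in b0; apply: le_trans b0.
  rewrite le_eqVlt; apply/orP; left; apply/eqP.
  rewrite big1_eq /lagrangian_hess.
  set S1 := \sum_i _ * d2 _ _ _ _; set S2 := \sum_i (_ + _).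
  set S1' := \sum_i _ * (_ / 2); set S2' := \sum_i _.
  have -> : S2 = 2 * S2'.
    rewrite /S2 /S2' mulr_sumr; apply: eq_bigr => i _.
    have E3 := st3 i; have E4 := st4 i; have rg0 := rg i; have [_ [_ ds]] := st7 i.
    set r := xr xs i 0 in E3 rg0 *; set c := cos _ in E3 E4 *; set s := sin _ in E3 E4 *.
    set th := xth dd i 0.
    (* The second derivatives of [cos] and [sin] leave radial components of phi and lambda. A
       vanishing combination of the two radial stationarity equations, weighted by [r] and
       [xdel xs i 0], trades them for the single term in delta times nu. *)
    rewrite -[LHS]subr0 -[X in _ - X](mulr0 (th ^+ 2)).
    rewrite -[X in _ - _ * X](_ : r * (c * mphx y i 0 + s * mphy y i 0 - mgam y i 0)
      + xdel xs i 0 * (- c * mlx y i 0 - s * mly y i 0 - msig y i 0 + mnu y i 0)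
      + r * mgam y i 0 + xdel xs i 0 * msig y i 0 = 0); last first.
      by rewrite E3 E4 rg0 ds !mulr0 !addr0.
    by field.
  have -> : S1 = 2 * S1'.
    by rewrite /S1 /S1' mulr_sumr; apply: eq_bigr => i _; move: (d2 _ _ _ _) => q; field.
  rewrite -[d2 (fun v => d1 Df v (mp y)) _ _ _]/(d3 Df (xu xs) (mp y) (xu dd) (xu dd)).
  move: (d2 J _ _ _) (d3 _ _ _ _ _) S1' S2' => {}p q r s; by field.
- rewrite (stationary_first_order (xu (D n)) (C3_C2 CD) MS).
  rewrite -[d1 (fun v => d1 Df v (mp y)) _ _]/(d2 Df (xu xs) (mp y) (xu (D n))).
  have -> : \sum_i (mrho y i 0 + mnu y i 0) * d1 (Qc Q i) (xal xs) (xal (D n)) = 0.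
    rewrite -[RHS](stationary_alpha (xal (D n)) st2); apply: eq_bigr => i _.
    by rewrite [in RHS]mxE.
  rewrite [X in _ * 0 + X]big1 => [|i _].
    by move: (d2 _ _ _ _) (\sum_i _) => p q; ring.
  (* Collecting the increments of r, delta and theta gives exactly the left-hand sides of the three
     pointwise stationarity equations as coefficients. *)
  rewrite -[RHS](_ : xr (D n) i 0 * (cos (xth xs i 0) * mphx y i 0 + sin (xth xs i 0) * mphy y i 0 - mgam y i 0)
    + xdel (D n) i 0 * (- cos (xth xs i 0) * mlx y i 0 - sin (xth xs i 0) * mly y i 0 - msig y i 0 + mnu y i 0)
    + xth (D n) i 0 * (sin (xth xs i 0) * (- xr xs i 0 * mphx y i 0 + xdel xs i 0 * mlx y i 0)
           - cos (xth xs i 0) * (- xr xs i 0 * mphy y i 0 + xdel xs i 0 * mly y i 0)) = 0).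
    by ring.
  by rewrite st3 st4 st5 !mulr0 !addr0.
- apply: filterS near_c => n nc.
  (* The [-1] factors and the right-nested sums in [lagrangian] mirror the way [e] is assembled from
     [expand2D] and [expand2Z], so its base value is the Lagrangian at [xs] by conversion. *)
  rewrite -[leRHS]/(lagrangian Kx Ky Df J Q y xs).
  rewrite (_ : _ + _ = lagrangian Kx Ky Df J Q y (tvstep xs (t n) (D n))); last first.
    rewrite /lagrangian; congr (_ + (_ + (_ + (_ + _)))).
    by apply: eq_bigr => i _; rewrite /= !coord_step; ring.
  rewrite !lagrangian_feasible //.
  rewrite [X in _ <= _ - X]big1 ?subr0 => [|i _]; last first.
    have [_ [_ ds]] := st7 i; have [_ [_ Qr]] := st6 i.
    by rewrite mulrC rg mulrC ds mulrC Qr Qn !addr0.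
  rewrite lerBlDr (le_trans (Jle n)) // lerDl; apply: sumr_ge0 => i _.
  have [_ [_ [_ [Q0 [del0 com]]]]] := feasn n.
  have [r0 [Qd0 _]] := com i; have [nA nI] := nc i.
  have [_ [rho0 _]] := st6 i; have [_ [sig0 _]] := st7 i.
  rewrite !addr_ge0 //; [|exact: mulr_ge0|exact: mulr_ge0|].
  + have := feasible_index i feas => /or3P[iA|iI|iB].
    * by rewrite nA // mulr0.
    * by rewrite st9 // mul0r.
    * by rewrite mulr_ge0 //; have [] := SS i iB.
  + have := feasible_index i feas => /or3P[iA|iI|iB].
    * by rewrite st8 // mul0r.
    * by rewrite nI // subrr mulr0.
    * by rewrite mulr_ge0 //; have [] := SS i iB.
Qed.

(** * Comparison of [soc_expr] with the Hessian of the Lagrangian *)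

Lemma sum_mul_le (R : realType) (I : finType) (P P' : pred I) (a b : I -> R) :
  (forall i, 0 <= a i) -> (forall i, 0 <= b i) -> (forall i, P i -> P' i) ->
  \sum_(i | P i) a i * b i <= (\sum_(i | P i) a i) * (\sum_(i | P' i) b i).
Proof.
move=> a0 b0 PP'; rewrite mulr_suml; apply: ler_sum => i Pi; apply: ler_wpM2l => //.
by rewrite (bigD1 i) ?PP' //= lerDl sumr_ge0.
Qed.

(** [c * fy - s * fx] is the tangential component of the vector in the frame rotated by the angle;
    its square is the squared norm minus the squared radial component. The rest is non-negativity of
    a square. *)
Lemma young_angular (R : realType) (c s fx fy a da dth : R) :
  c ^+ 2 + s ^+ 2 = 1 -> a ^+ 2 <= da ->
  - ((fx ^+ 2 + fy ^+ 2) * da) - dth ^+ 2 <= 2 * (c * fy - s * fx) * a * dth.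
Proof.
move=> cs ad.
have w2 : (c * fy - s * fx) ^+ 2 <= fx ^+ 2 + fy ^+ 2.
  rewrite -subr_ge0 (_ : _ - _ = (c * fx + s * fy) ^+ 2) ?sqr_ge0 //.
  rewrite -[fx ^+ 2 + _]mul1r -cs; ring.
have le1 : (c * fy - s * fx) ^+ 2 * a ^+ 2 <= (fx ^+ 2 + fy ^+ 2) * da.
  by apply: ler_pM => //; exact: sqr_ge0.
have := sqr_ge0 ((c * fy - s * fx) * a + dth); lra.
Qed.

(** The angular terms are compared index by index. On [inI] there are two cross terms, with [xr dd]
    and with [xdel dd], and each use of [young_angular] costs one square of [xth dd]: hence the
    constant 2. On [inB] the second cross term vanishes, hence 1. On [inA] both vanish, and so does
    nu. *)
Lemma soc_expr_le_hess (R : realType) (d m k : nat) (Kx Ky : 'M[R]_(m, d))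
    (Df J : 'cV[R]_d -> R) (Q : 'cV[R]_k -> 'cV[R]_m) (xs dd : tvpoint R d m k)
    (y : tvmult R d m) :
  feasible Kx Ky Df Q xs -> Mstat Kx Ky Df J Q xs y ->
  critical Kx Ky Df J Q xs dd ->
  (forall i, 0 < xr xs i 0 \/ 0 < xdel xs i 0) ->
  soc_expr Kx Ky Df J Q xs y dd <= lagrangian_hess Df J Q xs y dd.
Proof.
move=> feas MS crit nd.
have [_ [_ [lx [ly [_ [_ [st5 [_ [_ [st8 _]]]]]]]]]] := MS.
have [_ [_ [c3 [c4 [_ [_ [_ [_ [c9 [c10 _]]]]]]]]]] := crit.
pose P i := mphx y i 0 ^+ 2 + mphy y i 0 ^+ 2.
pose A i := (Kx *m xu dd) i 0 ^+ 2 + (Ky *m xu dd) i 0 ^+ 2.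
pose L i := (Kx *m mp y) i 0 ^+ 2 + (Ky *m mp y) i 0 ^+ 2.
pose G i := gQ Q (xal xs) i (xal dd) ^+ 2.
have P0 i : 0 <= P i by rewrite addr_ge0 ?sqr_ge0.
have A0 i : 0 <= A i by rewrite addr_ge0 ?sqr_ge0.
have L0 i : 0 <= L i by rewrite addr_ge0 ?sqr_ge0.
have G0 i : 0 <= G i by rewrite sqr_ge0.
(* [soc_expr] contains products of sums. The index-wise sums produced by Young's inequality are
   smaller because all terms are non-negative, and the operator norm then bounds the sum of the
   [A i]. *)
have PA : \sum_(i | inI Q xs i || inB Q xs i) P i * A i <=
    (\sum_(i | inI Q xs i || inB Q xs i) P i) * opnormK Kx Ky ^+ 2 * sqn (xu dd).
  apply: (le_trans (@sum_mul_le R _ _ predT _ _ P0 A0 _)) => //.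
  rewrite -mulrA ler_wpM2l ?sumr_ge0 // big_split; exact: opnormK_ub.
have LG : \sum_(i | inI Q xs i) L i * G i <=
    (\sum_(i | inI Q xs i) L i) * (\sum_(i | inI Q xs i) G i).
  exact: sum_mul_le.
(* In the frame rotated by theta_i, the vector K d_u at [i] has radial component [xr dd i 0] and
   tangential component r times [xth dd i 0]. *)
have AE i : A i = xr dd i 0 ^+ 2 + xr xs i 0 ^+ 2 * xth dd i 0 ^+ 2.
  have cs := cos2Dsin2 (xth xs i 0).
  have kx : (Kx *m xu dd) i 0 = cos (xth xs i 0) * xr dd i 0 - xr xs i 0 * sin (xth xs i 0) * xth dd i 0.
    by have := c3 i; lra.
  have ky : (Ky *m xu dd) i 0 = sin (xth xs i 0) * xr dd i 0 + xr xs i 0 * cos (xth xs i 0) * xth dd i 0.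
    by have := c4 i; lra.
  by rewrite /A kx ky -[RHS]mul1r -cs; ring.
have rA i : xr dd i 0 ^+ 2 <= A i.
  by rewrite AE lerDl mulr_ge0 ?sqr_ge0.
pose ang i := 2 * (cos (xth xs i 0) * mphy y i 0 - sin (xth xs i 0) * mphx y i 0)
              * xr dd i 0 * xth dd i 0
            - 2 * (cos (xth xs i 0) * mly y i 0 - sin (xth xs i 0) * mlx y i 0)
              * xdel dd i 0 * xth dd i 0
            + xdel xs i 0 * mnu y i 0 * xth dd i 0 ^+ 2.
have angle : \sum_(i | inI Q xs i) (xdel xs i 0 * mnu y i 0 - 2) * xth dd i 0 ^+ 2
   + \sum_(i | inB Q xs i) (xdel xs i 0 * mnu y i 0 - 1) * xth dd i 0 ^+ 2
   - \sum_(i | inI Q xs i || inB Q xs i) P i * A i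
   - \sum_(i | inI Q xs i) L i * G i <= \sum_i ang i.
  rewrite [X in X + _ - _ - _]big_mkcond [X in _ + X - _ - _]big_mkcond.
  rewrite [X in _ + _ - X - _]big_mkcond [X in _ - X]big_mkcond /=.
  rewrite -big_split -!sumrB; apply: ler_sum => i _ /=.
  (* For r = 0 the theta-equation of stationarity reads delta times the tangential part of lambda
     equals 0, and [nd] makes delta positive. *)
  have tangential : xr xs i 0 = 0 ->
      cos (xth xs i 0) * mly y i 0 - sin (xth xs i 0) * mlx y i 0 = 0.
    move=> r0; have dpos : 0 < xdel xs i 0 by have [|//] := nd i; rewrite r0 ltxx.
    apply: (mulfI (lt0r_neq0 dpos)); rewrite mulr0; have := st5 i; rewrite r0; lra.
  have cs := cos2Dsin2 (xth xs i 0).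
  have Yr := young_angular (mphx y i 0) (mphy y i 0) (xth dd i 0) cs (rA i).
  rewrite -/(P i) in Yr.
  have := feasible_index i feas => /or3P[iA|iI|iB].
  - have [/eqP r0 dQ] := andP iA.
    have nI : inI Q xs i = false by rewrite /inI r0 ltxx.
    have nB : inB Q xs i = false by rewrite /inB (gt_eqF dQ) andbF.
    by rewrite nI nB /ang (tangential r0) c10 // st8 // !(mulr0, mul0r) !(subr0, addr0).
  - have [r0 _] := andP iI.
    have nB : inB Q xs i = false by rewrite /inB gt_eqF.
    rewrite iI nB /=.
    (* The sign of [xdel dd] is flipped because its cross term enters with a minus; on [inI]
       criticality identifies its square with [G i]. *)
    have := @young_angular R _ _ (mlx y i 0) (mly y i 0) (- xdel dd i 0) (G i) (xth dd i 0) cs.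
    rewrite sqrrN /G c9 // lexx => /(_ isT).
    rewrite lx ly -/(L i) in st5 * => Yd.
    rewrite /ang lx ly; lra.
  - have [/eqP r0 _] := andP iB.
    have nI : inI Q xs i = false by rewrite /inI r0 ltxx.
    rewrite iB nI /= /ang (tangential r0); lra.
have arith (q p a a' S b b' T1 T2 an : R) : a' <= a -> b' <= b -> T1 + T2 - a' - b' <= an ->
    q - p - a - S - b + T1 + T2 <= q - p - S + an by lra.
exact: arith PA LG angle.
Qed.

Lemma soc_nondegenerate (R : realType) (d m k : nat) (Kx Ky : 'M[R]_(m, d))
    (Df J : 'cV[R]_d -> R) (Q : 'cV[R]_k -> 'cV[R]_m) (xs : tvpoint R d m k)
    (y : tvmult R d m) :
  feasible Kx Ky Df Q xs ->
  (forall i, inB Q xs i -> Q (xal xs) i 0 <> 0) ->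
  (forall dd, critical Kx Ky Df J Q xs dd -> dd <> zero_point R d m k ->
     0 < soc_expr Kx Ky Df J Q xs y dd) ->
  forall i, 0 < xr xs i 0 \/ 0 < xdel xs i 0.
Proof.
move=> feas BQ soc i.
have [_ [_ [_ [_ [del0 com]]]]] := feas.
have [r0 _] := com i.
have [rp|rn] := boolP (0 < xr xs i 0); first by left.
have [dp|dn] := boolP (0 < xdel xs i 0); first by right.
have {rn r0} r0 : xr xs i 0 = 0 by apply/eqP; rewrite eq_le r0 andbT leNgt.
have {dn} d0 : xdel xs i 0 = 0 by apply/eqP; rewrite eq_le del0 andbT leNgt.
have nI : inI Q xs i = false by rewrite /inI r0 ltxx.
(* Membership in [inB] with delta = 0 would give Q = 0, which [BQ] excludes. So [i] is in neither
   [inI] nor [inB], and its angle enters no sum of [soc_expr]. *)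
have nB : inB Q xs i = false.
  apply/negP => iB; apply: (BQ i iB); by move: iB => /andP[_ /eqP ->].
pose dd : tvpoint R d m k := TVPoint 0 0 0 0 0 0 (evec R i).
have eE j : evec R i j 0 = (j == i)%:R by rewrite mxE eqxx andbT.
have rth j : xr xs j 0 * evec R i j 0 = 0.
  by rewrite eE; have [->|] := eqVneq; rewrite ?r0 ?mul0r ?mulr0.
have dth j : xdel xs j 0 * evec R i j 0 = 0.
  by rewrite eE; have [->|] := eqVneq; rewrite ?d0 ?mul0r ?mulr0.
have z0 n (j : 'I_n) : (0 : 'cV[R]_n) j 0 = 0 by rewrite mxE.
have d10 n (f : 'cV[R]_n -> R) u : d1 f u 0 = 0 by rewrite /d1 linear0.
have d20 n (f : 'cV[R]_n -> R) u h : d2 f u h 0 = 0 by rewrite /d2 linear0.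
have d30 n (f : 'cV[R]_n -> R) u h l : d3 f u h l 0 = 0 by rewrite /d3 linear0.
have g0 j : gQ Q (xal xs) j 0 = 0 by rewrite gQE d10.
have cr : critical Kx Ky Df J Q xs dd.
  refine (conj _ (conj _ (conj _ (conj _ (conj _ (conj _ (conj _ (conj _ (conj _ (conj _ _)))))))))).
  - by rewrite /= d10.
  - rewrite /= !mulmx0 !subr0; apply/colP => j; rewrite !mxE.
    by rewrite d20 oppr0.
  - by move=> j; rewrite /= mulmx0 !z0 mulrAC rth !(mulr0, mul0r, oppr0, addr0).
  - by move=> j; rewrite /= mulmx0 !z0 mulrAC rth !(mulr0, mul0r, oppr0, addr0).
  - by move=> j; rewrite /= !z0 mulrAC dth !(mulr0, mul0r, oppr0, addr0).
  - by move=> j; rewrite /= !z0 mulrAC dth !(mulr0, mul0r, oppr0, addr0).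
  - by move=> j _; rewrite /= g0.
  - by move=> j _; rewrite /= mxE.
  - by move=> j _; rewrite /= g0 mxE.
  - by move=> j _; rewrite /= mxE.
  - by move=> j _; rewrite /= g0 mxE subr0 mul0r.
have nz : dd <> zero_point R d m k.
  move=> [] /(congr1 (fun v : 'cV[R]_m => v i 0)) /eqP.
  by rewrite eE mxE eqxx oner_eq0.
have := soc dd cr nz; rewrite /soc_expr /= d20 d30.
rewrite sqn0.
rewrite [X in _ - _ - _ - X - _ + _ + _]big1 => [|j _]; last by rewrite d20 mulr0.
rewrite [X in _ - _ * X + _ + _]big1 => [|j _]; last by rewrite g0 expr0n.
rewrite [X in _ + X + _]big1 => [|j jI]; last first.
  by rewrite eE; have [ji|] := eqVneq; rewrite ?expr0n ?mulr0 //; rewrite ji nI in jI.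
rewrite [X in _ + X]big1 => [|j jB]; last first.
  by rewrite eE; have [ji|] := eqVneq; rewrite ?expr0n ?mulr0 //; rewrite ji nB in jB.
by rewrite !(mulr0, oppr0, addr0) ltxx.
Qed.

(** * Unit directions, their limit, and the final contradiction *)

Definition tvsq (R : realType) (d m k : nat) (D : tvpoint R d m k) : R :=
  sqn (xu D) + sqn (xqx D) + sqn (xqy D) + sqn (xal D) + sqn (xr D) + sqn (xdel D) + sqn (xth D).

Lemma tvpoint_direction (R : realType) (d m k : nat) (xs x : tvpoint R d m k) :
  x <> xs -> exists (t : R) (D : tvpoint R d m k),
    [/\ 0 < t, t ^+ 2 = pdist2 x xs, tvsq D = 1 & x = tvstep xs t D].
Proof.
move=> xxs.
have p0 : 0 <= pdist2 x xs by rewrite /pdist2 !addr_ge0 ?sqn_ge0.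
have pn0 : pdist2 x xs != 0.
  apply/eqP => /eqP; rewrite /pdist2 !paddr_eq0 ?addr_ge0 ?sqn_ge0 // => e.
  apply: xxs; case: x xs e {p0} => u qx qy al r dl th [u' qx' qy' al' r' dl' th'] /=.
  by do !(case/andP); do !(move=> /eqP /sqn_eq0 /subr0_eq ->).
set t := Num.sqrt (pdist2 x xs).
have t2 : t ^+ 2 = pdist2 x xs by rewrite sqr_sqrtr.
have t0 : 0 < t by rewrite sqrtr_gt0 lt_def pn0.
have tn : t != 0 by rewrite gt_eqF.
exists t, (TVPoint (t^-1 *: (xu x - xu xs)) (t^-1 *: (xqx x - xqx xs)) (t^-1 *: (xqy x - xqy xs))
  (t^-1 *: (xal x - xal xs)) (t^-1 *: (xr x - xr xs)) (t^-1 *: (xdel x - xdel xs)) (t^-1 *: (xth x - xth xs))).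
split => //.
- rewrite /tvsq /= !sqnZ -!mulrDr -/(pdist2 x xs) -t2 exprVn mulVf //.
  by rewrite expf_neq0.
- rewrite /tvstep /= !scalerA mulfV // !scale1r.
  by rewrite ![_ + (_ - _)]addrC !subrK; case: (x).
Qed.

Lemma ultra_tvcvg (R : realType) (d m k : nat) (T : Type) (U : set_system T)
    (D : T -> tvpoint R d m k) :
  UltraFilter U -> (forall n, tvsq (D n) = 1) ->
  exists2 dd, tvcvg U D dd & tvsq dd = 1.
Proof.
move=> UU D1.
have PU : ProperFilter U by exact: ultra_proper.
have vec n (h : T -> 'cV[R]_n) : (forall x, sqn (h x) <= 1) -> exists l : 'cV[R]_n, h @ U --> l.
  move=> h1.
  have lim i : exists l : R, h x i 0 @[x --> U] --> l.
    apply: (ultra_bounded_cvg (b := 1)) => x.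
    rewrite -(@expr_le1 _ 2) // real_normK ?num_real //.
    exact: le_trans (sqn_coord _ _) (h1 x).
  have [l hl] := choice lim.
  exists (\col_i l i); apply: cvg_mx_coord => i j.
  by rewrite mxE [j]ord1; exact: hl.
have sq n (h : T -> 'cV[R]_n) l : h @ U --> l -> sqn (h x) @[x --> U] --> sqn l.
  move=> hl; apply: cvg_sumr => i _.
  by apply: cvgM; exact: cvg_coord.
have le1 x : sqn (xu (D x)) <= 1 /\ sqn (xqx (D x)) <= 1 /\ sqn (xqy (D x)) <= 1 /\
    sqn (xal (D x)) <= 1 /\ sqn (xr (D x)) <= 1 /\ sqn (xdel (D x)) <= 1 /\ sqn (xth (D x)) <= 1.
  have arith (a b c e f g h : R) : 0 <= a -> 0 <= b -> 0 <= c -> 0 <= e -> 0 <= f -> 0 <= g ->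
      0 <= h -> a + b + c + e + f + g + h = 1 ->
      a <= 1 /\ b <= 1 /\ c <= 1 /\ e <= 1 /\ f <= 1 /\ g <= 1 /\ h <= 1 by lra.
  by apply: arith (D1 x); exact: sqn_ge0.
have [u hu] : exists l : 'cV[R]_d, xu (D x) @[x --> U] --> l.
  by apply: (vec _ (fun x => xu (D x))) => x; have [? [? [? [? [? []]]]]] := le1 x.
have [qx hqx] : exists l : 'cV[R]_m, xqx (D x) @[x --> U] --> l.
  by apply: (vec _ (fun x => xqx (D x))) => x; have [? [? [? [? [? []]]]]] := le1 x.
have [qy hqy] : exists l : 'cV[R]_m, xqy (D x) @[x --> U] --> l.
  by apply: (vec _ (fun x => xqy (D x))) => x; have [? [? [? [? [? []]]]]] := le1 x.
have [al hal] : exists l : 'cV[R]_k, xal (D x) @[x --> U] --> l.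
  by apply: (vec _ (fun x => xal (D x))) => x; have [? [? [? [? [? []]]]]] := le1 x.
have [r hr] : exists l : 'cV[R]_m, xr (D x) @[x --> U] --> l.
  by apply: (vec _ (fun x => xr (D x))) => x; have [? [? [? [? [? []]]]]] := le1 x.
have [dl hdl] : exists l : 'cV[R]_m, xdel (D x) @[x --> U] --> l.
  by apply: (vec _ (fun x => xdel (D x))) => x; have [? [? [? [? [? []]]]]] := le1 x.
have [th hth] : exists l : 'cV[R]_m, xth (D x) @[x --> U] --> l.
  by apply: (vec _ (fun x => xth (D x))) => x; have [? [? [? [? [? []]]]]] := le1 x.
exists (TVPoint u qx qy al r dl th); first by split.
(* The squared norm is continuous in the components, so its value 1 passes to the limit and keeps
   the limit direction away from zero. *)
have lim : tvsq (D x) @[x --> U] --> tvsq (TVPoint u qx qy al r dl th).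
  by do !apply: cvgD; exact: sq.
have lim1 : tvsq (D x) @[x --> U] --> (1 : R).
  by rewrite (_ : (fun x => _) = cst 1); [exact: cvg_cst|apply/funext => x; rewrite D1].
exact: cvg_unique lim lim1.
Qed.

Theorem theorem3p5 (R : realType) (d m k : nat)
  (Kx Ky : 'M[R]_(m, d)) (Df J : 'cV[R]_d -> R) (Q : 'cV[R]_k -> 'cV[R]_m)
  (xs : tvpoint R d m k) :
  (0 < d)%N -> (0 < m)%N -> (0 < k)%N ->
  convex_fun Df -> C3 Df -> C2 J -> (forall i, C2 (Qc Q i)) ->
  feasible Kx Ky Df Q xs ->
  \rank (JQt Q (xal xs)) = minn k m ->
  (forall i, inB Q xs i -> Q (xal xs) i 0 <> 0) ->
  Sstat Kx Ky Df J Q xs ->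
  (forall (y : tvmult R d m) (dd : tvpoint R d m k),
     Mstat Kx Ky Df J Q xs y -> critical Kx Ky Df J Q xs dd ->
     dd <> zero_point R d m k ->
     0 < soc_expr Kx Ky Df J Q xs y dd) ->
  strict_local_min Kx Ky Df J Q xs.
Proof.
move=> _ _ _ _ CD CJ CQ feas _ BQ [y [MS SS]] soc.
have nd := soc_nondegenerate feas BQ (fun dd => soc y dd MS).
split; first exact: feas.
apply: contrapT => nomin.
have approx (n : nat) : exists tD : R * tvpoint R d m k,
    [/\ 0 < tD.1, tD.1 < n.+1%:R^-1, tvsq tD.2 = 1,
      feasible Kx Ky Df Q (tvstep xs tD.1 tD.2) &
      J (xu (tvstep xs tD.1 tD.2)) <= J (xu xs)].
  apply: contrapT => noseq; apply: nomin.
  have e0 : 0 < n.+1%:R^-1 :> R by rewrite invr_gt0 ltr0n.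
  (* [pdist2] is a squared distance, so the radius is squared in order to obtain a step length below
     [n.+1%:R^-1]. *)
  exists (n.+1%:R^-1 ^+ 2); split=> [|x feasx xxs px]; first by rewrite exprn_gt0.
  rewrite ltNge; apply/negP => Jx; apply: noseq.
  have [t [D [t0 t2 D1 xE]]] := tvpoint_direction xxs.
  exists (t, D); split => //=; rewrite -?xE //.
  - by move: px; rewrite -t2 ltr_pXn2r // nnegrE ltW.
  - by move: Jx; rewrite {1}xE.
have [tD tDP] := choice approx.
pose t n := (tD n).1; pose D n := (tD n).2.
have t0 n : 0 < t n by have [] := tDP n.
have feasn n : feasible Kx Ky Df Q (tvstep xs (t n) (D n)) by have [] := tDP n.
have Jle n : J (xu (tvstep xs (t n) (D n))) <= J (xu xs) by have [] := tDP n.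
have [U [UU sU]] := ultraFilterLemma (F := \oo) _.
have PU : ProperFilter U by exact: ultra_proper.
(* Limits along [\oo] remain limits along the finer [U]. *)
have tcvg : t @ U --> 0.
  apply: cvg_trans (_ : t @ U `=>` t @ \oo) _; first by move=> A; exact: sU.
  apply: (cvg_between (t := harmonic)) cvg_harmonic => n.
  by rewrite t0 /=; have [] := tDP n.
have [dd Dcvg dd1] := ultra_tvcvg UU (fun n => let: And5 _ _ D1 _ _ := tDP n in D1 : tvsq (D n) = 1).
have crit := limit_critical PU CD CJ CQ t0 tcvg Dcvg feas feasn Jle.
have ddnz : dd <> zero_point R d m k.
  move=> dd0; move: dd1; rewrite dd0 /tvsq /= !sqn0 !addr0.
  by move/eqP; rewrite eq_sym oner_eq0.
have hess0 := lagrangian_hess_le0 PU CD CJ CQ t0 tcvg Dcvg feas feasn Jle MS SS.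
have := soc y dd MS crit ddnz.
by rewrite ltNge (le_trans (soc_expr_le_hess feas MS crit nd) hess0).
Qed.
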